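(* Assume there exists an integer $q\ge1$ such that $\sigma(q)<(\gamma b)^q$. Then $\vartheta$ is absolutely continuous with respect to Lebesgue measure on $\mathbb{R}/\mathbb{Z}\times\mathbb{R}$ with square integrable density; in particular, for Lebesgue a.e. $x\in[0,1)$, $m_x$ is absolutely continuous with respect to Lebesgue measure on $\mathbb{R}$ with square integrable density.
   Context: Standing setup: $b\ge2$ is an integer, $\mathcal{A}=\{0,\dots,b-1\}$, $\gamma\in(1/b,1)$, $\psi:\mathbb{R}\to\mathbb{R}$ is a $\mathbb{Z}$-periodic $C^1$ function, $\mathbb{P}$ is the uniform Bernoulli measure on $\mathcal{A}^{\mathbb{Z}^+}$. For $x\in\mathbb{R}$, $\mathbf{i}\in\mathcal{A}^{\mathbb{Z}^+}$: $S(x,\mathbf{i})=\sum_{n\ge1}\gamma^{n-1}\psi\big(\frac{x+i_1+i_2b+\cdots+i_nb^{n-1}}{b^n}\big)$, and $S'(x,\mathbf{i})=\partial_xS(x,\mathbf{i})$. $m_x$ is the push-forward of $\mathbb{P}$ under $\mathbf{i}\mapsto S(x,\mathbf{i})$, and $\vartheta(B)=\int_0^1m_x(B_x)dx$ on $\mathbb{R}/\mathbb{Z}\times\mathbb{R}\cong[0,1)\times\mathbb{R}$, $B_x=\{y:(x,y)\in B\}$ (the SRB measure of $T(x,y)=(bx\bmod1,\gamma y+\psi(x))$). For $x\in\mathbb{R}$ and $\mathbf{u}=(u_1,\dots,u_q)\in\mathcal{A}^q$ put $x(\mathbf{u})=\frac{x+u_1+u_2b+\cdots+u_qb^{q-1}}{b^q}$.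 For $\mathbf{k}\in\mathcal{A}^q$, $\mathbf{u}\in\mathcal{A}^{\mathbb{Z}^+}$, $\mathbf{ku}$ denotes concatenation. Two sequences $\mathbf{i},\mathbf{j}\in\mathcal{A}^{\mathbb{Z}^+}$ are $(\varepsilon,\delta)$-tangent at $x_0$ if $|S(x_0,\mathbf{i})-S(x_0,\mathbf{j})|\le\varepsilon$ and $|S'(x_0,\mathbf{i})-S'(x_0,\mathbf{j})|\le\delta$. $E(q,x_0;\varepsilon,\delta)$ is the set of $(\mathbf{k},\mathbf{l})\in\mathcal{A}^q\times\mathcal{A}^q$ for which there are $\mathbf{u},\mathbf{v}\in\mathcal{A}^{\mathbb{Z}^+}$ with $\mathbf{ku},\mathbf{lv}$ $(\varepsilon,\delta)$-tangent at $x_0$. A weight function is a measurable $\omega:[0,1)\to(0,\infty)$ with $\|\omega\|_\infty,\|1/\omega\|_\infty<\infty$. A testing function of order $q$ is a measurable $V:[0,1)\times\mathcal{A}^q\times\mathcal{A}^q\to[0,\infty)$; it is admissible if there exist $\varepsilon,\delta>0$ such that for all $x\in[0,1)$ and $(\mathbf{u},\mathbf{v})\in E(q,x;\varepsilon,\delta)$, $V(x,\mathbf{u},\mathbf{v})V(x,\mathbf{v},\mathbf{u})\ge1$. Put $\Sigma_{V,\omega}(x)=\sup_{\mathbf{u}\in\mathcal{A}^q}\frac{\omega(x)}{\omega(x(\mathbf{u}))}\sum_{\mathbf{v}\in\mathcal{A}^q}V(x,\mathbf{u},\mathbf{v})$ and $\sigma(q)=\inf\|\Sigma_{V,\omega}\|_\infty$,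 the infimum over all weight functions $\omega$ and admissible testing functions $V$ of order $q$. *)

(* Defs.v *)
From HB Require Import structures.
From mathcomp Require Import all_boot all_order all_algebra.
From mathcomp Require Import all_classical all_reals all_analysis.

Set Implicit Arguments.
Unset Strict Implicit.
Unset Printing Implicit Defensive.
Import Order.TTheory GRing.Theory Num.Theory.
Import numFieldNormedType.Exports.
Local Open Scope classical_set_scope.
Local Open Scope ring_scope.

Section Defs.
Variable R : realType.
Variable b : nat.
Variable gamma : R.
Variable psi : R -> R.

(* A = 'I_b ; A^{Z+} = nat -> 'I_b, with i 0 playing the role of i_1. *)
Definition seqA := nat -> 'I_b.

Definition I01 : set R := `[0%R, 1%R[%classic.

Definition digsum (i : seqA) (n : nat) : R :=
  \sum_(j < n) (i j)%:R * (b%:R) ^+ j.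

Definition S (x : R) (i : seqA) : R :=
  limn (fun N => \sum_(0 <= n < N)
          gamma ^+ n * psi ((x + digsum i n.+1) / (b%:R) ^+ n.+1)).

Definition S' (x : R) (i : seqA) : R := derive1 (fun y => S y i) x.

Definition xu (q : nat) (x : R) (u : q.-tuple 'I_b) : R :=
  (x + \sum_(j < q) (tnth u j)%:R * (b%:R) ^+ j) / (b%:R) ^+ q.

Definition concat (q : nat) (k : q.-tuple 'I_b) (u : seqA) : seqA :=
  fun n => match (insub n : option 'I_q) with
           | Some j => tnth k j
           | None => u (n - q)%N
           end.

Definition tangent (eps del x0 : R) (i j : seqA) : Prop :=
  `|S x0 i - S x0 j| <= eps /\ `|S' x0 i - S' x0 j| <= del.

Definition Eset (q : nat) (x0 eps del : R) :
    set (q.-tuple 'I_b * q.-tuple 'I_b) :=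
  [set kl | exists u v : seqA, tangent eps del x0 (concat kl.1 u) (concat kl.2 v)].

Definition esssup01 (f : R -> R) : \bar R :=
  ereal_inf [set y : \bar R | {ae (@lebesgue_measure R),
     forall x, I01 x -> ((f x)%:E <= y)%E}].

Definition weight_function (w : R -> R) : Prop :=
  measurable_fun I01 w /\
  (forall x, I01 x -> 0 < w x) /\
  (esssup01 (fun x => `|w x|%R) < +oo)%E /\
  (esssup01 (fun x => `|(w x)^-1|%R) < +oo)%E.

Definition testing_function (q : nat)
    (V : R -> q.-tuple 'I_b -> q.-tuple 'I_b -> R) : Prop :=
  (forall u v, measurable_fun I01 (fun x => V x u v)) /\
  (forall x u v, I01 x -> 0 <= V x u v).

Definition admissible (q : nat)
    (V : R -> q.-tuple 'I_b -> q.-tuple 'I_b -> R) : Prop :=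
  exists eps del : R, 0 < eps /\ 0 < del /\
    forall x, I01 x ->
      forall u v, @Eset q x eps del (u, v) -> 1 <= V x u v * V x v u.

(* Sigma_{V,omega}(x) = sup_u omega(x)/omega(x(u)) sum_v V(x,u,v);
   the sup over the finite nonempty set A^q of nonnegative reals is a max. *)
Definition SigmaVw (q : nat)
    (V : R -> q.-tuple 'I_b -> q.-tuple 'I_b -> R) (w : R -> R) (x : R) : R :=
  \big[Num.max/0]_(u : q.-tuple 'I_b)
     (w x / w (xu x u) * \sum_(v : q.-tuple 'I_b) V x u v).

Definition sigma (q : nat) : \bar R :=
  ereal_inf [set e : \bar R | exists (w : R -> R)
      (V : R -> q.-tuple 'I_b -> q.-tuple 'I_b -> R),
      [/\ weight_function w, testing_function V, admissible V &
          e = esssup01 (SigmaVw V w)]].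

End Defs.

Section MeasDefs.
Variable R : realType.
Variable b : nat.
Variable gamma : R.
Variable psi : R -> R.
Hypothesis b_gt0 : (0 < b)%N.

(* A^{Z+} as a pointed type (needed for measurable structures) *)
Definition digit := 'I_b.
HB.instance Definition _ := Choice.on digit.
HB.instance Definition _ := isPointed.Build digit (Ordinal b_gt0).
Definition seqP : pointedType := nat -> digit.

Definition cyl (n : nat) (w : n.-tuple 'I_b) : set seqP :=
  [set i | forall j : 'I_n, i j = tnth w j].

Definition cylinders : set (set seqP) :=
  [set C | exists n (w : n.-tuple 'I_b), C = cyl w].

Definition SeqSpace : measurableType cylinders.-sigma :=
  g_sigma_algebraType cylinders.

Definition uniform_bernoulli (P : probability SeqSpace R) : Prop :=
  forall n (w : n.-tuple 'I_b), P (cyl w) = ((b%:R : R) ^- n)%:E.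

Definition mx (P : probability SeqSpace R) (x : R) (B : set R) : \bar R :=
  P ((fun i : SeqSpace => S gamma psi x i) @^-1` B).

Definition vartheta (P : probability SeqSpace R) (B : set (R * R)) : \bar R :=
  (\int[@lebesgue_measure R]_(x in @I01 R) mx P x (xsection B x))%E.

End MeasDefs.

(* Main.v *)
Require Import Defs.
From HB Require Import structures.
From mathcomp Require Import all_boot all_order all_algebra.
From mathcomp Require Import all_classical all_reals all_analysis.
From mathcomp Require Import measurable_realfun ring lra.
Import Order.TTheory GRing.Theory Num.Theory.
Import numFieldNormedType.Exports.
Set Implicit Arguments.
Unset Strict Implicit.
Unset Printing Implicit Defensive.
Local Open Scope classical_set_scope.
Local Open Scope ring_scope.

(** Following Tsujii, put [E_r(x) = \int_y m_x(B(y, r))^2].  The self-similarity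
    [m_x = b^-q \sum_u (f_(x, u))_* m_(x(u))] with contractions of ratio [gamma^q]
    expands [E_r(x)] into a sum over pairs [(u, v)].  For pairs in
    [E(q, x; eps, del)] the cross term is split by AM-GM with the weights
    [V(x, u, v)], [V(x, v, u)] into diagonal terms
    [gamma^q E_(r / gamma^q)(x(u))]; for the other pairs the branches
    [S(., u i) - S(., v j)] are transversal to [0], so their contribution, once
    integrated in [x], is [O(r^2)].  Weighting by [w] and integrating,
    [J(r) = r^-2 \int w E_r] satisfies [J(r) <= theta J(r / gamma^q) + C] with
    [theta = ||Sigma_(V, w)|| / (gamma b)^q < 1], so [J] is bounded along
    [r_n = r_0 gamma^(q n)].
    By Fatou, for almost every [x] the averages [m_x(B(y, r_n)) / (2 r_n)] are
    bounded in [L^2(dy)] along a subsequence, which forces [m_x] to be absolutely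
    continuous; by Lebesgue differentiation the averages converge to its density,
    and their upper limit is a jointly measurable density of [vartheta]. *)

(** The factor [theta] has four sources: expanding the square costs [b^(-2q)], the change of
    variables in [y] gives [gamma^q], the [b^q] maps [x -> x(u)] tile [[0, 1)] and give [b^q], and
    comparing [r^-2] with [(r / gamma^q)^-2] gives [gamma^(-2q)]. Their product is [(gamma b)^-q].
    The weight is forced by the fact that the energies reappear at the points [x(u)]: a bound on
    [Sigma_(V, w)] bounds [w(x) \sum_v V(x, u, v)] by a multiple of [w(x(u))], so the same weighted
    integral returns after tiling. The transversal terms are estimated by exchanging integrals: for
    a fixed pair of digit sequences one measures the set of [x] where the two branches are close.
    The estimate must be uniform in the pair, which rests on a modulus of differentiability of
    [S(., i)] independent of [i]; periodicity and continuity of [psi'] provide it. Fatou controls a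
    lower limit only, so for a given [x] the averages are bounded along infinitely many radii that
    depend on [x]. The criterion for absolute continuity is shaped to accept this. *)

(** * Measures on the line *)

(* The canonical measure structure of [pushforward] takes the measurability
   proof as an argument, hence cannot be inferred from the function alone. *)
Definition image_measure d d' (T1 : measurableType d) (T2 : measurableType d')
    (R : realType) (m : {measure set T1 -> \bar R}) (f : T1 -> T2)
    (mf : measurable_fun setT f) : {measure set T2 -> \bar R} :=
  measure_function_pushforward__canonical__measure_function_Measure m mf.

Lemma measurable_affine (R : realType) (a c : R) :
  measurable_fun setT
    (fun y : measurableTypeR R => (a * y + c)%R : measurableTypeR R).
Proof. by apply: measurable_funD => //; apply: measurable_funM. Qed.

(** Multiplied by [a], the image of Lebesgue measure gives every half-open interval its length,
    which characterises Lebesgue measure. *)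
Lemma lebesgue_measure_affine (R : realType) (a c : R) (A : set R) :
  0 < a -> measurable A ->
  (lebesgue_measure ((fun y => (a * y + c)%R) @^-1` A) =
   (a^-1)%:E * lebesgue_measure A)%E.
Proof.
move=> a0 mA.
pose nu : {measure set (measurableTypeR R) -> \bar R} :=
  mscale (NngNum (ltW a0))
    (image_measure (@lebesgue_measure R) (measurable_affine a c)).
have -> : lebesgue_measure ((fun y => (a * y + c)%R) @^-1` A) =
  ((a^-1)%:E * nu A)%E.
  by rewrite /nu /= /mscale /= muleA -EFinM mulVf ?gt_eqF// mul1e.
congr (_ * _)%E; apply/esym/lebesgue_measure_unique => //= _ [[x y]] _ <-.
rewrite /nu /mscale /= /pushforward.
have -> : (fun y => (a * y + c)%R) @^-1` `]x, y] = `](x - c) / a, (y - c) / a]%classic.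
  apply/seteqP; split=> z /=; rewrite !in_itv/= ltr_pdivrMr// ler_pdivlMr// ltrBlDr lerBrDr;
  by rewrite ![z * a]mulrC.
rewrite !lebesgue_measure_itv/= !lte_fin ltr_pM2r ?invr_gt0// ltrD2r.
case: ifPn => _; last by rewrite mule0.
by rewrite -!EFinD -EFinM; congr EFin; field; rewrite gt_eqF.
Qed.

Lemma ge0_integral_affine (R : realType) (a c : R) (D : set R) (f : R -> \bar R) :
  0 < a -> measurable D -> measurable_fun D f -> (forall y, D y -> 0 <= f y)%E ->
  (\int[lebesgue_measure]_(y in [set y | D (a * y + c)%R]) f (a * y + c)%R =
   (a^-1)%:E * \int[lebesgue_measure]_(y in D) f y)%E.
Proof.
move=> a0 mD mf f0.
have i0 : 0 <= a^-1 by rewrite invr_ge0 ltW.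
have := @ge0_integral_pushforward _ _ _ _ R _ (measurable_affine a c)
  (@lebesgue_measure R) D f mD mf.
move=> /(_ (fun y yD => f0 y (set_mem yD))) <-.
rewrite -(@ge0_integral_mscale _ _ _ (@lebesgue_measure R) D mD (NngNum i0) f mf f0).
apply: (eq_measure_integral (mscale (NngNum i0) lebesgue_measure)
  (m1 := image_measure lebesgue_measure (measurable_affine a c))) => A mA _.
exact: lebesgue_measure_affine.
Qed.

(** * Calculus of the function S *)

Section periodic.
Variable R : realType.
Implicit Types (f : R -> R) (x : R).

Lemma periodic_nat f x (n : nat) : (forall y, f (y + 1) = f y) ->
  f (x + n%:R) = f x.
Proof.
move=> pf; elim: n => [|n ih]; first by rewrite addr0.
by rewrite -natr1 addrA pf.
Qed.

Lemma periodic_int f x (n : int) : (forall y, f (y + 1) = f y) ->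
  f (x + n%:~R) = f x.
Proof.
move=> pf; case: n => n; first exact: periodic_nat.
rewrite NegzE mulrNz -(@periodic_nat f _ n.+1 pf).
by congr f; rewrite -pmulrn addrNK.
Qed.

(** Compactness of [[0, 1]] makes the radius uniform for [x] in that interval and arbitrary real
    [y]; periodicity does the rest. *)
Lemma periodic_unif_continuous f (e : R) : (forall y, f (y + 1) = f y) ->
  continuous f -> 0 < e ->
  exists2 d : R, 0 < d & forall x y, `|x - y| < d -> `|f x - f y| < e.
Proof.
move=> pf cf e0.
have [F01 _] := @compact_near_coveringP R `[0, 1]%classic.
have cK : compact (`[0, 1]%classic : set R) by exact: segment_compact.
have := (F01 cK) R (0^'+) (fun d x => forall y, `|x - y| < d -> `|f x - f y| < e).
move=> /(_ _ _)[x _|d /= d0 dP].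
- have /cvgrPdist_lt/(_ (e / 2)) := cf x.
  rewrite divr_gt0// => /(_ isT)[d /= d0 dP].
  exists (ball x (d / 2), `]0, (d / 2)[%classic).
    split; first by apply: nbhsx_ballx; rewrite divr_gt0.
    exists (d / 2) => /=; first by rewrite divr_gt0.
    move=> z /=; rewrite sub0r normrN in_itv/= => zd z0.
    by rewrite z0 (le_lt_trans (ler_norm _) zd).
  move=> [x' i] /= [xx' +] y x'y; rewrite in_itv/= => /andP[i0 id].
  have h1 : `|f x - f x'| < e / 2.
    apply: dP => /=; move: xx'; rewrite /ball/= => h; apply: lt_le_trans h _.
    by rewrite ler_pdivrMr// ler_peMr// ?ler1n// ltW.
  have h2 : `|f x - f y| < e / 2.
    apply: dP => /=; rewrite (splitr d) -(subrKA x').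
    by rewrite (le_lt_trans (ler_normD _ _))// ltrD// (lt_trans x'y).
  rewrite (splitr e) -(subrKA (f x)) (le_lt_trans (ler_normD _ _))// ltrD//.
  by rewrite distrC.
exists (d / 2); first by rewrite divr_gt0.
move=> x y xy.
have d2 : ball 0 d (d / 2).
  by rewrite /ball/= sub0r normrN gtr0_norm ?divr_gt0// ltr_pdivrMr// ltr_pMr// ltr1n.
(* Both points are translated by the floor of [x]: this keeps their distance, and only [x] has to
   land in [[0, 1]]. *)
have := dP _ d2; rewrite divr_gt0// => /(_ isT (x - (Num.floor x)%:~R)).
rewrite /= in_itv/= subr_ge0 floor_le/= lerBlDl -intrD1 (ltW (floorD1_gt _)).
move=> /(_ isT (y - (Num.floor x)%:~R)).
rewrite opprB addrA subrK => /(_ xy).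
by rewrite -!mulrNz !periodic_int.
Qed.

Lemma periodic_bounded f : (forall y, f (y + 1) = f y) -> continuous f ->
  exists2 M : R, 0 < M & forall x, `|f x| <= M.
Proof.
move=> pf cf.
have cg : {within `[0, 1]%classic, continuous (fun x => `|f x|)}.
  apply: continuous_subspaceT => x; apply: continuous_comp; first exact: cf.
  exact: norm_continuous.
have [c _ cP] := EVT_max ler01 cg.
exists (`|f c| + 1); first by rewrite ltr_wpDl.
move=> x; rewrite -(@periodic_int f x (- Num.floor x))// mulrNz.
apply: (le_trans (cP _ _)); last by rewrite lerDl.
by rewrite in_itv/= subr_ge0 floor_le/= lerBlDl -intrD1 (ltW (floorD1_gt _)).
Qed.

Lemma derive1_periodic f x : (forall y, f (y + 1) = f y) ->
  derive1 f (x + 1) = derive1 f x.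
Proof.
move=> pf; rewrite /derive1.
suff -> : (fun h => h^-1 *: (f (h + (x + 1)) - f (x + 1))) =
  (fun h => h^-1 *: (f (h + x) - f x)) by [].
by apply/funext => h; rewrite addrA !pf.
Qed.

(** The mean value theorem gives a point between [z] and [y], hence still within [d] of [x], where
    uniform continuity compares the derivative with that at [x]. *)
Lemma periodic_strong_derivative f (e : R) : (forall y, f (y + 1) = f y) ->
  (forall x, derivable f x 1) -> continuous (derive1 f) -> 0 < e ->
  exists2 d : R, 0 < d & forall x y z, `|y - x| < d -> `|z - x| < d ->
    `|f y - f z - derive1 f x * (y - z)| <= e * `|y - z|.
Proof.
move=> pf df cf e0.
have pf' y : derive1 f (y + 1) = derive1 f y by exact: derive1_periodic.
have [d d0 dP] := periodic_unif_continuous pf' cf e0.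
exists d => // x y z.
wlog zy : y z / z <= y => [H yx zx|yx zx].
  have [|/ltW] := leP z y; first by move=> ?; exact: H.
  move=> yz; have := H _ _ yz zx yx.
  suff -> : f y - f z - derive1 f x * (y - z) =
    - (f z - f y - derive1 f x * (z - y)) by rewrite normrN (distrC y z).
  by ring.
have := @MVT_segment R f (derive1 f) z y zy.
move=> [w _||c].
- by rewrite derive1E; apply/derivableP.
- apply: continuous_subspaceT => w.
  by apply: differentiable_continuous; apply/derivable1_diffP.
rewrite in_itv/= => /andP[zc cy] ->.
rewrite -mulrBl normrM ler_wpM2r//; apply/ltW/dP.
move: yx zx; rewrite !ltr_norml => /andP[? ?] /andP[? ?].
by apply/andP; split; lra.
Qed.

End periodic.

Section S_analysis.
Variables (R : realType) (b : nat) (gamma : R) (psi : R -> R).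
Hypothesis b_ge2 : (2 <= b)%N.
Hypothesis gamma01 : 0 < gamma < 1.
Hypothesis psi_periodic : forall x : R, psi (x + 1) = psi x.
Hypothesis psi_derivable : forall x : R, derivable psi x 1.
Hypothesis psi'_continuous : continuous (derive1 psi).

Let psi_continuous : continuous psi.
Proof. by move=> x; apply: differentiable_continuous; apply/derivable1_diffP. Qed.

Let psi'_periodic x : derive1 psi (x + 1) = derive1 psi x.
Proof. exact: derive1_periodic. Qed.

Let b_gt0 : 0 < b%:R :> R.
Proof. by rewrite ltr0n; apply: leq_trans b_ge2. Qed.

(** Kept general in [f], since the derivative series has the same terms with [derive1 psi]. *)
Definition S_term (f : R -> R) (x : R) (i : seqA b) (n : nat) : R :=
  gamma ^+ n * f ((x + digsum R i n.+1) / b%:R ^+ n.+1).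

Lemma cvg_S_term (f : R -> R) x i (M : R) : (forall y, `|f y| <= M) ->
  cvgn (series (S_term f x i)).
Proof.
move=> fM; have /andP[g0 g1] := gamma01; apply: normed_cvg.
apply: (@series_le_cvg _ _ (geometric M gamma)) => [n|n|n|].
- exact: normr_ge0.
- rewrite /geometric/= mulr_ge0//; last by rewrite exprn_ge0 ?ltW.
  exact: le_trans (normr_ge0 _) (fM 0).
- rewrite /geometric/= /S_term normrM ger0_norm ?exprn_ge0 ?(ltW g0)// mulrC.
  by rewrite ler_pM2r ?exprn_gt0.
- by apply: is_cvg_geometric_series; rewrite ger0_norm ?ltW.
Qed.

Lemma S_cvg x i : series (S_term psi x i) N @[N --> \oo] --> S gamma psi x i.
Proof.
have [M _ fM] := periodic_bounded psi_periodic psi_continuous.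
exact: (cvg_S_term fM).
Qed.

Lemma digsum_concat (q : nat) (k : q.-tuple 'I_b) (u : seqA b) m :
  digsum R (concat k u) (q + m) =
  \sum_(j < q) (tnth k j)%:R * (b%:R) ^+ j + b%:R ^+ q * digsum R u m.
Proof.
rewrite /digsum big_split_ord/=; congr (_ + _).
  apply: eq_bigr => j _; rewrite /concat/=; case: insubP => [j' _ jj'|].
    by rewrite (_ : j' = j)//; exact: val_inj.
  by rewrite ltn_ord.
rewrite mulr_sumr; apply: eq_bigr => j _.
rewrite /concat insubF ?ltnNge ?leq_addr//= addKn exprD.
by rewrite mulrCA.
Qed.

Lemma digsum_concat_prefix (q : nat) (k : q.-tuple 'I_b) (u v : seqA b) m :
  (m <= q)%N -> digsum R (concat k u) m = digsum R (concat k v) m.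
Proof.
move=> mq; apply: eq_bigr => j _; rewrite /concat; case: insubP => // /negP[].
by rewrite (leq_trans (ltn_ord j)).
Qed.

Lemma S_concat (q : nat) (k : q.-tuple 'I_b) x :
  exists c, forall u : seqA b,
    S gamma psi x (concat k u) = c + gamma ^+ q * S gamma psi (xu x k) u.
Proof.
pose d : 'I_b := Ordinal (leq_trans (isT : (0 < 2)%N) b_ge2).
(* The first [q] terms read only the digits of [k], so any fixed tail, here the constant digit [0],
   yields the constant. *)
exists (\sum_(0 <= n < q) S_term psi x (concat k (fun=> d)) n) => u.
apply/cvg_lim => //.
rewrite -(cvg_shiftn q) /=.
have -> : (fun N => \sum_(0 <= n < N + q) gamma ^+ n *
    psi ((x + digsum R (concat k u) n.+1) / b%:R ^+ n.+1)) =
  (fun N => \sum_(0 <= n < q) S_term psi x (concat k (fun=> d)) n +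
    gamma ^+ q * series (S_term psi (xu x k) u) N).
  apply/funext => N; rewrite (@big_cat_nat _ _ _ q)/= ?leq_addl//; congr (_ + _).
    apply: eq_big_nat => n /andP[_ nq].
    by rewrite /S_term (digsum_concat_prefix _ _ (fun=> d)).
  rewrite -{1}[q]add0n big_addn addnK /series/= mulr_sumr.
  apply: eq_big_nat => n _.
  rewrite /S_term addnC -addnS digsum_concat exprD -mulrA; congr (_ * (_ * psi _)).
  rewrite /xu exprD; field.
  by rewrite !expf_neq0 ?gt_eqF.
apply: cvgD; first exact: cvg_cst.
by apply: cvgM; [exact: cvg_cst|exact: S_cvg].
Qed.

Lemma xu_I01 (q : nat) (k : q.-tuple 'I_b) (x : R) : I01 x -> I01 (xu x k).
Proof.
rewrite /I01 /= !in_itv/= => /andP[x0 x1].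
have h0 : 0 <= \sum_(j < q) (tnth k j)%:R * (b%:R) ^+ j :> R.
  by apply: sumr_ge0 => j _; rewrite mulr_ge0// exprn_ge0// ltW.
have h1 : \sum_(j < q) (tnth k j)%:R * (b%:R) ^+ j <= b%:R ^+ q - 1 :> R.
  have -> : b%:R ^+ q - 1 = \sum_(j < q) (b%:R - 1) * b%:R ^+ j :> R.
    by rewrite subrX1 mulr_sumr.
  apply: ler_sum => j _; rewrite ler_pM2r ?exprn_gt0// lerBrDr natr1 ler_nat.
  exact: ltn_ord.
rewrite /xu divr_ge0 ?addr_ge0// ?exprn_ge0 ?ltW//=.
by rewrite ltr_pdivrMr ?exprn_gt0// mul1r; lra.
Qed.

(* Estimating the increments of [S] against the termwise derivative, uniformly in
   the digits, gives both the derivative of [S] and its equicontinuity without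
   differentiating the series. *)
Lemma S_strong_derivative_aux (e : R) : 0 < e ->
  exists2 d : R, 0 < d & forall (i : seqA b) x y z,
    `|y - x| < d -> `|z - x| < d ->
    `|S gamma psi y i - S gamma psi z i -
      limn (series (fun n => b%:R^-1 ^+ n.+1 * S_term (derive1 psi) x i n)) * (y - z)|
    <= e * `|y - z|.
Proof.
move=> e0; have /andP[g0 g1] := gamma01.
(* The termwise errors are weighted by [gamma ^+ n], whose sum is at most [1 / (1 - gamma)]; the
   total is then at most [e]. *)
have e'0 : 0 < e * (1 - gamma) by rewrite mulr_gt0// subr_gt0.
have [d d0 dP] := periodic_strong_derivative psi_periodic psi_derivable psi'_continuous e'0.
have [M M0 fM] := periodic_bounded psi'_periodic psi'_continuous.
exists d => // i x y z yx zx.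
have b1 n : 0 <= (b%:R^-1 : R) ^+ n.+1 <= 1.
  have i0 : 0 <= (b%:R^-1 : R) by rewrite invr_ge0 ltW.
  rewrite exprn_ge0//= exprn_ile1// invf_le1// ler1n.
  exact: leq_trans b_ge2.
have cD : cvgn (series (fun n => b%:R^-1 ^+ n.+1 * S_term (derive1 psi) x i n)).
  apply: normed_cvg.
  apply: (@series_le_cvg _ _ (geometric M gamma)) => [n|n|n|].
  - exact: normr_ge0.
  - by rewrite /geometric/= mulr_ge0 ?exprn_ge0 ?ltW.
  - have /andP[bn0 bn1] := b1 n.
    rewrite /geometric/= /S_term normrM (ger0_norm bn0) normrM ger0_norm ?exprn_ge0 ?(ltW g0)//.
    rewrite (@le_trans _ _ (1 * (gamma ^+ n * M)))//; last by rewrite mul1r mulrC.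
    by apply: ler_pM => //; [rewrite mulr_ge0// exprn_ge0// ltW|rewrite ler_pM2l ?exprn_gt0].
  - by apply: is_cvg_geometric_series; rewrite ger0_norm ?ltW.
have hcv : (fun N => `|series (S_term psi y i) N - series (S_term psi z i) N -
    series (fun n => b%:R^-1 ^+ n.+1 * S_term (derive1 psi) x i n) N * (y - z)|) @ \oo -->
  `|S gamma psi y i - S gamma psi z i -
      limn (series (fun n => b%:R^-1 ^+ n.+1 * S_term (derive1 psi) x i n)) * (y - z)|.
  apply: cvg_norm; apply: cvgB; first by apply: cvgB; exact: S_cvg.
  by apply: cvgM; [exact: cD|exact: cvg_cst].
apply: (cvgr_to_le hcv); apply: nearW => N.
rewrite /series/= mulr_suml -!sumrB.
apply: (le_trans (ler_norm_sum _ _ _)).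
apply: (@le_trans _ _ (\sum_(0 <= n < N) e * (1 - gamma) * `|y - z| * gamma ^+ n)).
  apply: ler_sum_nat => n _; have /andP[bn0 bn1] := b1 n.
  rewrite /S_term; set p := digsum R i n.+1; set B := _ ^+ n.+1 in b1 bn0 bn1 *.
  have -> : (b%:R ^+ n.+1) = B^-1 :> R by rewrite /B -exprVn invrK.
  rewrite !invrK.
  have -> : gamma ^+ n * psi ((y + p) * B) - gamma ^+ n * psi ((z + p) * B) -
    B * (gamma ^+ n * derive1 psi ((x + p) * B)) * (y - z) =
    gamma ^+ n * (psi ((y + p) * B) - psi ((z + p) * B) -
     derive1 psi ((x + p) * B) * ((y + p) * B - (z + p) * B)) by ring.
  rewrite normrM ger0_norm ?exprn_ge0 ?(ltW g0)// mulrC ler_pM2r ?exprn_gt0//.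
  (* The inverse branches contract, so one [d] serves every term and every digit sequence. *)
  have hB w : `|w - x| < d -> `|(w + p) * B - (x + p) * B| < d.
    rewrite -mulrBl opprD addrACA subrr addr0 normrM (ger0_norm bn0).
    by apply: le_lt_trans; rewrite ler_piMr.
  apply: (le_trans (dP _ _ _ (hB _ yx) (hB _ zx))).
  rewrite -mulrBl opprD addrACA subrr addr0 normrM (ger0_norm bn0).
  by rewrite ler_pM2l// ler_piMr.
rewrite -mulr_sumr.
have gs : \sum_(0 <= n < N) gamma ^+ n <= (1 - gamma)^-1.
  rewrite -[X in X <= _](_ : series (geometric 1 gamma) N = _); last first.
    by apply: eq_bigr => n _; rewrite /geometric/= mul1r.
  rewrite geometric_seriesE ?lt_eqF//= mul1r ler_pdivrMr ?subr_gt0//.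
  by rewrite mulVf ?gt_eqF ?subr_gt0// gerBl exprn_ge0 ?ltW.
rewrite mulrAC -mulrA mulrC mulrAC.
rewrite [leLHS](_ : _ =
  e * `|y - z| * ((1 - gamma) * \sum_(0 <= n < N) gamma ^+ n)); last by ring.
rewrite -[leRHS]mulr1 ler_wpM2l ?mulr_ge0 ?(ltW e0)//.
by rewrite mulrC -ler_pdivlMr ?subr_gt0// mul1r.
Qed.

Lemma S'E (i : seqA b) x :
  S' gamma psi x i =
  limn (series (fun n => b%:R^-1 ^+ n.+1 * S_term (derive1 psi) x i n)).
Proof.
set D := limn _; rewrite /S' /derive1; apply/cvg_lim => //.
apply/cvgrPdist_le => e e0; have [d d0 dP] := S_strong_derivative_aux e0.
exists d => //= h /=; rewrite sub0r normrN => hd h0.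
have := dP i x (h + x) x; rewrite addrK subrr normr0 => /(_ hd d0) H.
rewrite -/D in H.
have -> : D - h^-1 * (S gamma psi (h + x) i - S gamma psi x i) =
  - (h^-1 * (S gamma psi (h + x) i - S gamma psi x i - D * h)).
  by field.
by rewrite normrN normrM normfV ler_pdivrMl ?normr_gt0// (mulrC `|h|).
Qed.

Lemma S_strong_derivative (e : R) : 0 < e ->
  exists2 d : R, 0 < d & forall (i : seqA b) x y z,
    `|y - x| < d -> `|z - x| < d ->
    `|S gamma psi y i - S gamma psi z i - S' gamma psi x i * (y - z)| <= e * `|y - z|.
Proof.
move=> e0; have [d d0 dP] := S_strong_derivative_aux e0.
by exists d => // i x y z yx zx; rewrite S'E; exact: dP.
Qed.

End S_analysis.

(** * Absolute continuity from L2 bounds on ball averages *)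

Lemma fubini_sections d1 d2 (T1 : measurableType d1) (T2 : measurableType d2)
    (R : realType) (m1 : {sigma_finite_measure set T1 -> \bar R})
    (m2 : {sigma_finite_measure set T2 -> \bar R}) (A : set (T1 * T2)) :
  measurable A ->
  (\int[m1]_x m2 (xsection A x) = \int[m2]_y m1 (ysection A y))%E.
Proof.
move=> mA.
have -> : (fun x => m2 (xsection A x)) = fubini_F m2 (EFin \o (\1_A : _ -> R)).
  by rewrite indic_fubini_tonelli_FE.
have -> : (fun y => m1 (ysection A y)) = fubini_G m1 (EFin \o (\1_A : _ -> R)).
  by rewrite indic_fubini_tonelli_GE.
apply: fubini_tonelli => //.
  by apply/measurable_EFinP; exact: measurable_indic.
by move=> x; rewrite lee_fin.
Qed.

Lemma measurable_set_lt d (T : measurableType d) (R : realType) (f : T -> R) (c : R) :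
  measurable_fun setT f -> measurable [set x | f x < c].
Proof.
move=> mf; rewrite [X in measurable X](_ : _ = setT `&` f @^-1` `]-oo, c[%classic).
  by apply: mf.
by apply/seteqP; split => x /=; rewrite in_itv/=; tauto.
Qed.

Lemma measurable_set_gt d (T : measurableType d) (R : realType) (f : T -> R) (c : R) :
  measurable_fun setT f -> measurable [set x | c < f x].
Proof.
move=> mf; rewrite [X in measurable X](_ : _ = setT `&` f @^-1` `]c, +oo[%classic).
  by apply: mf.
by apply/seteqP; split => x /=; rewrite in_itv/= andbT; tauto.
Qed.

Lemma measurable_ball_graph (R : realType) (r : R) :
  measurable [set p : R * R | `|p.1 - p.2| < r].
Proof.
apply: (@measurable_set_lt _ _ R (fun p : R * R => `|p.1 - p.2|)).
apply: measurableT_comp => //; apply: measurable_funB.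
- exact: measurable_fst.
- exact: measurable_snd.
Qed.

Lemma ae_mono d (T : measurableType d) (R : realType)
    (mu : {measure set T -> \bar R}) (A B : T -> Prop) :
  (forall x, A x -> B x) ->
  {ae mu, forall x, A x} -> {ae mu, forall x, B x}.
Proof. by move=> AB; apply: filterS. Qed.

Lemma ae_mono2 d (T : measurableType d) (R : realType)
    (mu : {measure set T -> \bar R}) (A B C : T -> Prop) :
  (forall x, A x -> B x -> C x) ->
  {ae mu, forall x, A x} -> {ae mu, forall x, B x} -> {ae mu, forall x, C x}.
Proof. by move=> ABC; apply: filterS2. Qed.

Section ball_measure.
Context (R : realType).
Local Notation leb := (@lebesgue_measure R).
Variable m : probability (measurableTypeR R) R.

Lemma measurable_ball_measure (r : R) :
  measurable_fun setT (fun y : R => m (ball y r)).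
Proof.
have := measurable_fun_xsection m (measurable_ball_graph r).
congr (measurable_fun _ _); apply/funext => y /=; congr (m _).
by apply/seteqP; split => z; rewrite /xsection/= inE.
Qed.

Lemma measure_ball_fineK (r y : R) : ((fine (m (ball y r)))%:E = m (ball y r))%E.
Proof. by rewrite fineK// fin_num_measure//; exact: measurable_ball. Qed.

Lemma measurable_fine_ball_measure (r : R) :
  measurable_fun setT (fun y : R => fine (m (ball y r))).
Proof.
by apply: measurableT_comp; [exact: fine_measurable|exact: measurable_ball_measure].
Qed.

(* [W] lies in the [r]-erosion of [U], so [m W <= \int_U a] with
   [a y = m (ball y r) / (2 r)]; then [a <= t a^2 + 1 / (4 t)] avoids Hoelder. *)
Lemma open_erosion_bound (U : set R) (r t L : R) : 0 < r -> 0 < t -> open U ->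
  (leb U <= (t ^+ 2)%:E)%E ->
  (\int[leb]_y ((fine (m (ball y r)) / (2 * r)) ^+ 2)%:E <= L%:E)%E ->
  forall W : set R, measurable W -> (forall z : R, W z -> ball z r `<=` U) ->
  (m W <= (t * (L + 4^-1))%:E)%E.
Proof.
move=> r0 t0 oU Ut hL W mW WU.
have mU : measurable U by exact: open_measurable.
(* The region is measured in both orders: for [z] in [W] its [y]-section is a full ball of length
   [2 r], while its section over [y] is contained in [ball y r] and is empty off [U]. *)
pose A := [set p : R * R | `|p.1 - p.2| < r] `&` (U `*` setT).
have mA : measurable A.
  by apply: measurableI; [exact: measurable_ball_graph|exact: measurableX].
have h1 : ((2 * r)%:E * m W <= \int[m]_z leb (ysection A z))%E.
  rewrite -(setIT W) -(integral_indic m measurableT mW).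
  rewrite -ge0_integralZl_EFin; [|exact: measurableT|..]; last 3 first.
  - by move=> z _; rewrite lee_fin.
  - by apply/measurable_EFinP; exact: measurable_indic.
  - by rewrite mulr_ge0 ?ltW.
  apply: ge0_le_integral => //.
  - by move=> z _; rewrite mule_ge0 ?lee_fin ?mulr_ge0 ?(ltW r0).
  - by apply: measurable_funeM; apply/measurable_EFinP; exact: measurable_indic.
  - exact: (measurable_fun_ysection leb mA).
  move=> z _; rewrite indicE; have [zW|_] := boolP (z \in W); last by rewrite mule0.
  rewrite mule1.
  have -> : ysection A z = ball z r.
    apply/seteqP; split => y; rewrite /ysection/= inE /A/=.
      by move=> [yz _]; apply: ball_sym.
    move=> zy; split; first exact: (ball_sym zy).
    by split => //; apply: (WU z) => //; exact: set_mem.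
  by rewrite lebesgue_measure_ball ?(ltW r0)// mulr_natl.
rewrite -(@fubini_sections _ _ _ _ _ leb m _ mA) in h1.
pose a y := fine (m (ball y r)) / (2 * r).
have a0 y : 0 <= a y by rewrite divr_ge0 ?fine_ge0// mulr_ge0 ?ltW.
have ma : measurable_fun setT a.
  by apply: measurable_funM => //; exact: measurable_fine_ball_measure.
have h2 : (\int[leb]_y m (xsection A y) <=
    (2 * r)%:E * \int[leb]_y (t%:E * (a y ^+ 2)%:E + ((4 * t)^-1)%:E * (\1_U y)%:E))%E.
  rewrite -ge0_integralZl_EFin; [|exact: measurableT|..]; last 3 first.
  - by move=> y _; rewrite adde_ge0// mule_ge0// lee_fin ?sqr_ge0 ?invr_ge0 ?mulr_ge0 ?(ltW t0).
  - apply: emeasurable_funD; apply: measurable_funeM; apply/measurable_EFinP.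
      exact: measurable_funX.
    exact: measurable_indic.
  - by rewrite mulr_ge0 ?ltW.
  apply: ge0_le_integral => //.
  - exact: (measurable_fun_xsection m mA).
  - apply: measurable_funeM; apply: emeasurable_funD; apply: measurable_funeM;
      apply/measurable_EFinP.
      exact: measurable_funX.
    exact: measurable_indic.
  move=> y _; rewrite indicE; have [yU|yU] := boolP (y \in U); last first.
    rewrite (_ : xsection A y = set0) ?measure0.
      rewrite mule0 adde0 !mule_ge0// ?lee_fin ?sqr_ge0 ?mulr_ge0 ?(ltW t0) ?(ltW r0)//.
    apply/seteqP; split => // z; rewrite /xsection/= inE /A/= => -[_ [yU' _]].
    by move/negP: yU; apply; rewrite inE.
  apply: (@le_trans _ _ (m (ball y r))).
    apply: le_measure; rewrite ?inE.
    - exact: measurable_xsection.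
    - exact: measurable_ball.
    - by move=> z; rewrite /xsection/= inE /A/= => -[].
  rewrite -measure_ball_fineK mule1.
  suff : fine (m (ball y r)) <= 2 * r * (t * a y ^+ 2 + (4 * t)^-1).
    by rewrite -lee_fin.
  have -> : fine (m (ball y r)) = 2 * r * a y.
    by rewrite /a mulrC divfK// mulf_neq0 ?gt_eqF.
  rewrite ler_pM2l ?mulr_gt0// -subr_ge0.
  (* Completing the square proves the elementary inequality that replaces Hoelder. *)
  have -> : t * a y ^+ 2 + (4 * t)^-1 - a y = (2 * t * a y - 1) ^+ 2 / (4 * t).
    by field; rewrite gt_eqF.
  by rewrite divr_ge0 ?sqr_ge0// mulr_ge0 ?ltW.
have := le_trans h1 h2; rewrite lee_pmul2l ?lte_fin ?mulr_gt0// => {h1 h2} h.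
apply: (le_trans h); rewrite ge0_integralD//; last 4 first.
- by move=> y _; rewrite mule_ge0// lee_fin ?sqr_ge0// ltW.
- by apply: measurable_funeM; apply/measurable_EFinP; exact: measurable_funX.
- by move=> y _; rewrite mule_ge0// lee_fin ?invr_ge0 ?mulr_ge0 ?(ltW t0).
- by apply: measurable_funeM; apply/measurable_EFinP; exact: measurable_indic.
rewrite ge0_integralZl_EFin; [|exact: measurableT|..]; last 3 first.
- by move=> y _; rewrite lee_fin sqr_ge0.
- by apply/measurable_EFinP; exact: measurable_funX.
- exact: ltW.
rewrite ge0_integralZl_EFin; [|exact: measurableT|..]; last 3 first.
- by move=> y _; rewrite lee_fin.
- by apply/measurable_EFinP; exact: measurable_indic.
- by rewrite invr_ge0 mulr_ge0// ltW.
rewrite integral_indic// setIT mulrDr EFinD leeD//.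
  by rewrite EFinM lee_pmul2l.
apply: (le_trans (lee_wpmul2l _ Ut)); first by rewrite lee_fin invr_ge0 mulr_ge0 ?ltW.
by rewrite -EFinM lee_fin le_eqVlt; apply/orP; left; apply/eqP; field; rewrite gt_eqF.
Qed.

(** An open set of length at most [t^2] has mass at most [t (L + 1/4)], as it is exhausted by its
    erosions. A null set lies in open sets of arbitrarily small length, so letting [t] tend to [0]
    gives mass zero. *)
Lemma null_dominates_ball_L2 (r : nat -> R) (L : R) :
  (forall n, 0 < r n) -> (forall i j, (i <= j)%N -> r j <= r i) ->
  r @ \oo --> (0 : R) ->
  (forall N, exists2 n, (N <= n)%N &
    (\int[leb]_y ((fine (m (ball y (r n))) / (2 * r n)) ^+ 2)%:E <= L%:E)%E) ->
  m `<< leb.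
Proof.
move=> r_gt0 r_dec r_cvg hL.
have L0 : 0 <= L.
  have [n _] := hL 0%N; rewrite -lee_fin; apply: le_trans.
  by apply: integral_ge0 => y _; rewrite lee_fin sqr_ge0.
have open_bound (U : set R) (t : R) : 0 < t -> open U ->
    (leb U <= (t ^+ 2)%:E)%E -> (m U <= (t * (L + 4^-1))%:E)%E.
  move=> t0 oU Ut.
  (* This is the set of points whose ball of radius [r n] lies in [U], written as a complement of
     open balls so that it is visibly closed. *)
  pose W n := ~` (\bigcup_(w in ~` U) ball w (r n)).
  have mW n : measurable (W n).
    apply: measurableC; apply: open_measurable; apply: bigcup_open => w _.
    exact: ball_open.
  have WU n z : W n z -> ball z (r n) `<=` U.
    move=> Wz w zw; apply: contrapT => nU; apply: Wz; exists w => //.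
    exact: ball_sym.
  have ndW : nondecreasing_seq W.
    move=> i j ij; apply/subsetPset => z; apply: contra_not => -[w nU wz].
    exists w => //; apply: le_ball wz; exact: r_dec.
  have UW : \bigcup_n W n = U.
    apply/seteqP; split => [z [n _ Wz]|z Uz].
      by apply: (WU n z Wz); apply: ballxx.
    have /nbhs_ballP[e /= e0 eU] : nbhs z U by exact: open_nbhs_nbhs.
    have /cvgrPdist_lt/(_ e e0)[n _ /(_ n (leqnn n))] := r_cvg.
    rewrite /= sub0r normrN gtr0_norm// => rne.
    exists n => // -[w nU wz]; apply: nU; apply: eU.
    by apply: (le_ball (ltW rne)); exact: ball_sym.
  have := @nondecreasing_cvg_mu _ _ _ m W mW _ ndW; rewrite UW.
  move=> /(_ (open_measurable oU)) hcv.
  rewrite -(cvg_lim _ hcv)//; apply: lime_le; first by apply/cvg_ex; exists (m U).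
  (* The energy bound holds for infinitely many radii only. The erosions increase with the index, so
     [W N] is contained in [W n] for a later index [n] where the bound holds. *)
  apply: nearW => N; have [n Nn hn] := hL N.
  apply: (@le_trans _ _ (m (W n))).
    by apply: le_measure; rewrite ?inE; [exact: mW|exact: mW|apply/subsetPset; exact: ndW].
  exact: (open_erosion_bound (r_gt0 n) t0 oU Ut hn (mW n) (WU n)).
apply/null_content_dominatesP => A mA A0.
apply/eqP; rewrite eq_le measure_ge0 andbT; apply/lee_addgt0Pr => e e0.
rewrite add0e.
(* Chosen so that [t * (L + 4^-1)] is exactly [e]. *)
pose t := e / (L + 4^-1).
have L4 : 0 < L + 4^-1 by rewrite ltr_wpDl// invr_gt0.
have t0 : 0 < t by rewrite divr_gt0.
have [|U [oU AU UA]] := @lebesgue_regularity_outer R A (t ^+ 2) mA _ (exprn_gt0 _ t0).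
  by rewrite A0.
apply: (@le_trans _ _ (m U)).
  by apply: le_measure; rewrite ?inE//; exact: open_measurable.
rewrite (_ : e = t * (L + 4^-1)); last by rewrite /t divfK// gt_eqF.
apply: open_bound => //.
have mU : measurable U by exact: open_measurable.
apply: (@le_trans _ _ (leb (U `\` A) + leb A)%E); last first.
  by rewrite A0 adde0 ltW.
rewrite -measureU//; last 2 first.
- exact: measurableD.
- by rewrite setDE -setIA setICl setI0.
apply: le_measure; rewrite ?inE//.
  by apply: measurableU => //; exact: measurableD.
by move=> z Uz; have [Az|nAz] := pselect (A z); [right|left].
Qed.

(** Radon-Nikodym supplies a finite-valued density, so [fine] loses nothing, and Lebesgue
    differentiation recovers it as the limit of the averages over balls. *)
Lemma ball_density (r : nat -> R) :
  (forall n, 0 < r n) -> r @ \oo --> (0 : R) -> m `<< leb ->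
  exists g : R -> R, [/\ measurable_fun setT g, (forall y, 0 <= g y),
    (forall A, measurable A -> m A = \int[leb]_(y in A) (g y)%:E)%E &
    {ae leb, forall y : R,
      (fine (m (ball y (r n))) / (2 * r n)) @[n --> \oo] --> g y}].
Proof.
move=> r_gt0 r_cvg hac.
have [f [f0 ffin fint mE]] := radon_nikodym_sigma_finite hac.
pose g y := fine (f y).
have fE y : (g y)%:E = f y by rewrite fineK.
have mg : measurable_fun setT g.
  apply: measurableT_comp; first exact: fine_measurable.
  exact: (measurable_int _ fint).
have mgE A : measurable A -> (m A = \int[leb]_(y in A) (g y)%:E)%E.
  by move=> mA; rewrite mE//; apply: eq_integral => y _; rewrite fE.
have locg : locally_integrable setT g.
  apply: open_integrable_locally; first exact: openT.
  by apply: eq_integrable fint => // y _ /=; rewrite fE.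
exists g; split => //; first by move=> y; exact: fine_ge0.
have := lebesgue_differentiation locg.
apply: ae_mono => y.
have nE : forall x : R, nicely_shrinking x (fun n => ball x (r n)).
  move=> x; split; first by move=> n; exact: measurable_ball.
  exists (1, fun n => PosNum (r_gt0 n)); split.
  - exact: ltr01.
  - exact: r_cvg.
  - by move=> n /= z.
  - by move=> n /=; rewrite mul1e.
move=> /(nice_lebesgue_differentiation nE locg).
rewrite [X in X @ _ --> _](_ : _ =
    (fun n => (fine (m (ball y (r n))) / (2 * r n))%:E)).
  by move=> /fine_cvgP[].
apply/funext => n.
rewrite lebesgue_measure_ball ?(ltW (r_gt0 n))// inver mulrn_eq0/= gt_eqF//.
rewrite -mgE; last exact: measurable_ball.
by rewrite -measure_ball_fineK -EFinM mulrC mulr_natl.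
Qed.

End ball_measure.

(** * The Bernoulli measure *)

Lemma big_tuple_cons (T : finType) (q : nat) (V : nmodType) (F : q.+1.-tuple T -> V) :
  \sum_(t : q.+1.-tuple T) F t =
  \sum_(a : T) \sum_(k : q.-tuple T) F (cons_tuple a k).
Proof.
rewrite pair_big/= (reindex (fun p : T * q.-tuple T => cons_tuple p.1 p.2))//=.
exists (fun t => (thead t, behead_tuple t)) => [[a k] _|t _] /=.
  by congr pair; apply: val_inj.
by rewrite [RHS]tuple_eta; apply: val_inj.
Qed.

(** One-digit concatenation, the step of the inductions on word length. *)
Definition scons (b : nat) (a : 'I_b) (u : seqA b) : seqA b :=
  fun n => if n is m.+1 then u m else a.

Lemma concat_cons (b q : nat) (a : 'I_b) (k : q.-tuple 'I_b) (u : seqA b) :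
  concat (cons_tuple a k) u = scons a (concat k u).
Proof.
apply/funext => -[|n]; rewrite /concat /=.
  by case: insubP => //= j _ j0; rewrite (_ : j = ord0)//; exact: val_inj.
case: insubP => [j jq jn|]; case: insubP => [j' jq' jn'|]//=.
- by rewrite !(tnth_nth a)/= jn /= jn'.
- by rewrite -ltnS jq.
- by rewrite ltnS jq'.
Qed.

Lemma concat_nil (b : nat) (k : 0.-tuple 'I_b) (u : seqA b) : concat k u = u.
Proof.
apply/funext => n; rewrite /concat; case: insubP => [[]//|_]; by rewrite subn0.
Qed.

Lemma xu_cons (R : realType) (b q : nat) (a : 'I_b) (k : q.-tuple 'I_b) (x : R) :
  (0 < b)%N -> xu x (cons_tuple a k) = xu ((x + a%:R) / b%:R) k.
Proof.
move=> b0; have b0' : b%:R != 0 :> R by rewrite pnatr_eq0 -lt0n.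
rewrite /xu big_ord_recl/= expr0 mulr1 (tnth_nth a)/=.
under eq_bigr => j _ do rewrite /bump/= add1n exprS (tnth_nth a)/= -(tnth_nth a) mulrCA.
rewrite -mulr_sumr exprS.
set s := \sum_(_ < _) _; field.
by rewrite expf_neq0.
Qed.

Lemma xu_nil (R : realType) (b : nat) (k : 0.-tuple 'I_b) (x : R) : xu x k = x.
Proof. by rewrite /xu big_ord0 addr0 expr0 divr1. Qed.

Section seqspace.
Variables (R : realType) (b : nat).
Hypothesis b_gt0 : (0 < b)%N.
Local Notation Om := (SeqSpace b_gt0).
Local Notation Cyl w := (@cyl b b_gt0 _ w : set Om).

Lemma measurable_cyl n (w : n.-tuple 'I_b) : measurable (Cyl w : set Om).
Proof. by apply: sub_sigma_algebra; exists n, w. Qed.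

(** There are finitely many words of length [n], so a set decided by the first [n] digits is a
    finite union of cylinders. *)
Lemma measurable_prefix (n : nat) (A : set Om) :
  (forall i j : Om, (forall k, (k < n)%N -> i k = j k) -> A i -> A j) ->
  measurable A.
Proof.
move=> hA.
rewrite (_ : A = \bigcup_(w in [set w : n.-tuple 'I_b | Cyl w `<=` A]) Cyl w).
  by apply: fin_bigcup_measurable => [|w _]; [exact: finite_finset|exact: measurable_cyl].
apply/seteqP; split => [i Ai|i [w /= wA iw]]; last exact: wA.
exists [tuple (i k : 'I_b) | k < n] => /=; last by move=> k; rewrite tnth_mktuple.
move=> j jw; apply: hA Ai => k kn.
by have := jw (Ordinal kn); rewrite tnth_mktuple.
Qed.

Lemma measurable_fun_prefix d (T : measurableType d) n (f : Om -> T) :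
  (forall i j : Om, (forall k, (k < n)%N -> i k = j k) -> f i = f j) ->
  measurable_fun setT f.
Proof.
move=> hf _ Y mY; rewrite setTI; apply: (@measurable_prefix n) => i j ij /=.
by rewrite (hf _ _ ij).
Qed.

Lemma measurable_digsum n : measurable_fun setT (fun i : Om => digsum R i n).
Proof.
apply: (@measurable_fun_prefix _ _ n) => i j ij.
by apply: eq_bigr => k _; rewrite ij.
Qed.

Lemma measurable_scons (a : 'I_b) : measurable_fun setT (scons a : Om -> Om).
Proof.
apply: (@measurability _ _ Om Om setT (scons a) (@cylinders b b_gt0)) => //.
move=> _ [_ [n [w ->]] <-]; rewrite setTI.
apply: (@measurable_prefix n) => i j ij iw k.
by rewrite -iw; case: k => -[|k] kn //=; rewrite ij// ltnW.
Qed.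

Lemma measurable_concat q (k : q.-tuple 'I_b) : measurable_fun setT (concat k : Om -> Om).
Proof.
elim: q k => [|q ih] k.
  rewrite (_ : (concat k : Om -> Om) = id); first exact: measurable_id.
  by apply/funext => u; exact: concat_nil.
rewrite (_ : (concat k : Om -> Om) =
  (scons (thead k) : Om -> Om) \o (concat (behead_tuple k) : Om -> Om)).
  by apply: measurableT_comp; [exact: measurable_scons|exact: ih].
apply/funext => u; rewrite /= -concat_cons; congr concat.
by rewrite [LHS]tuple_eta; apply: val_inj.
Qed.

(** Two cylinders are nested or disjoint; the empty set is added for the second case. *)
Lemma cylinders_setI_closed : setI_closed (@cylinders b b_gt0 `|` [set set0]).
Proof.
have key n m (w : n.-tuple 'I_b) (v : m.-tuple 'I_b) : (n <= m)%N ->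
    (@cylinders b b_gt0 `|` [set set0]) (Cyl w `&` Cyl v).
  move=> nm; have [->|/set0P[i [iw iv]]] := eqVneq (Cyl w `&` Cyl v) set0.
    by right.
  left; exists m, v; apply: setIidr => j jv k.
  rewrite -iw; have := jv (widen_ord nm k); have := iv (widen_ord nm k).
  by move=> /= -> ->.
move=> A B [[n [w ->]]|->]; last by rewrite set0I; right.
move=> [[m [v ->]]|->]; last by rewrite setI0; right.
have [/key//|/ltnW/key] := leqP n m.
by rewrite setIC.
Qed.

Variable P : probability Om R.
Hypothesis P_uniform : uniform_bernoulli P.

Lemma scons_preimage_cyl (a c : 'I_b) n (w : n.-tuple 'I_b) :
  (scons a : Om -> Om) @^-1` (Cyl (cons_tuple c w)) =
  if a == c then Cyl w else set0.
Proof.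
case: eqVneq => [<-|ac]; apply/seteqP; split => // i /=.
- by move=> h k; have := h (lift ord0 k); rewrite !(tnth_nth a).
- move=> h [[|k] kn]; rewrite !(tnth_nth a)//=.
  by have := h (Ordinal (kn : k < n)%N); rewrite (tnth_nth a).
- by move=> /(_ ord0); rewrite (tnth_nth a)/= => /eqP; rewrite (negbTE ac).
Qed.

(** The average of the images of [P] under prepending one digit agrees with [P] on cylinders, which
    together with the empty set form a generating family stable under intersection. *)
Lemma bernoulli_scons (A : set Om) : measurable A ->
  (P A = (b%:R^-1)%:E * \sum_(a : 'I_b) P ((scons a : Om -> Om) @^-1` A))%E.
Proof.
have i0 : 0 <= (b%:R^-1 : R) by rewrite invr_ge0.
pose a0 := Ordinal b_gt0.
(* [msum] is indexed by naturals, so digits enter through their enumeration, with [a0] as the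
   default value of [nth]. *)
pose nu : {measure set Om -> \bar R} := mscale (NngNum i0)
  (msum (fun n => image_measure P (measurable_scons (nth a0 (enum 'I_b) n))) b).
have nuE B : nu B = ((b%:R^-1)%:E * \sum_(a : 'I_b) P ((scons a : Om -> Om) @^-1` B))%E.
  rewrite /nu /mscale /= /msum/=; congr (_ * _)%E.
  by apply: eq_bigr => i _; rewrite nth_ord_enum.
move=> mA; rewrite -nuE.
apply: (@measure_unique _ R Om (@cylinders b b_gt0 `|` [set set0]) (fun=> setT)) => //.
- apply/seteqP; split.
    apply: smallest_sub; first exact: smallest_sigma_algebra.
    by move=> B cB; apply: sub_sigma_algebra; left.
  apply: smallest_sub; first exact: sigma_algebra_measurable.
  by move=> B [|->//]; exact: sub_sigma_algebra.
- exact: cylinders_setI_closed.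
- move=> _; left; exists 0%N, [tuple]; apply/seteqP; split => // i _ [].
  by [].
- by rewrite bigcup_const.
- move=> B [[n [w ->]]|->]; last by rewrite !measure0.
  rewrite nuE; case: n w => [|n] w.
    have -> : Cyl w = [set: Om] by apply/seteqP; split => // i _ [].
    under eq_bigr do rewrite preimage_setT probability_setT.
    transitivity (1%E : \bar R); first exact: probability_setT.
    rewrite (sumEFin _ _ (fun=> 1)) sumr_const card_ord.
    by rewrite -EFinM mulVf// pnatr_eq0 -lt0n.
  have [c [v ->]] : exists c (v : n.-tuple 'I_b), w = cons_tuple c v.
    by exists (thead w), (behead_tuple w); rewrite [LHS]tuple_eta; apply: val_inj.
  transitivity ((b%:R ^- n.+1)%:E : \bar R); first exact: P_uniform.
  under eq_bigr do rewrite scons_preimage_cyl.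
  rewrite (bigD1 c)//= eqxx big1 ?adde0; last first.
    by move=> a /negbTE ->; rewrite measure0.
  by rewrite P_uniform -EFinM exprS invfM.
- by move=> _; rewrite [X in (X < _)%E](_ : _ = 1%E) ?ltry//; exact: probability_setT.
Qed.

Lemma bernoulli_concat q (A : set Om) : measurable A ->
  (P A = (b%:R ^- q)%:E * \sum_(k : q.-tuple 'I_b) P ((concat k : Om -> Om) @^-1` A))%E.
Proof.
elim: q A => [|q ih] A mA.
  rewrite expr0 invr1 mul1e (big_pred1 [tuple])/=; last first.
    by move=> t; apply/esym/eqP; exact: tuple0.
  by congr (P _); apply/seteqP; split => i /=; rewrite concat_nil.
rewrite bernoulli_scons//.
under eq_bigr => a _.
  rewrite ih; last by rewrite -[X in measurable X]setTI; exact: measurable_scons.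
  over.
rewrite -ge0_sume_distrr; last first.
  by move=> a _; apply: sume_ge0 => k _; exact: measure_ge0.
rewrite muleA -EFinM -invfM -exprS big_tuple_cons; congr (_ * _)%E.
apply: eq_bigr => a _; apply: eq_bigr => k _; congr (P _).
by apply/seteqP; split => i /=; rewrite concat_cons.
Qed.

End seqspace.

Section S_measurable.
Variables (R : realType) (b : nat) (gamma : R) (psi : R -> R).
Hypothesis b_ge2 : (2 <= b)%N.
Hypothesis gamma01 : 0 < gamma < 1.
Hypothesis psi_periodic : forall x : R, psi (x + 1) = psi x.
Hypothesis psi_derivable : forall x : R, derivable psi x 1.
Local Notation Om := (SeqSpace (ltnW b_ge2)).

Lemma measurable_S :
  measurable_fun setT (fun p : R * Om => S gamma psi p.1 p.2).
Proof.
apply: (@measurable_fun_cvg _ _ _ _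
  (fun N (p : R * Om) => series (S_term gamma psi p.1 p.2) N)).
  move=> N; apply: measurable_sum => n; apply: measurable_funM => //.
  have cpsi : continuous psi.
    by move=> x; apply: differentiable_continuous; apply/derivable1_diffP.
  apply: measurableT_comp; first exact: continuous_measurable_fun.
  apply: measurable_funM => //; apply: measurable_funD; first exact: measurable_fst.
  apply: (measurableT_comp (f := fun i : Om => digsum R i n.+1)).
    exact: measurable_digsum.
  exact: measurable_snd.
by move=> p _; apply: S_cvg.
Qed.

Lemma measurable_Sx (x : R) : measurable_fun setT (fun i : Om => S gamma psi x i).
Proof.
exact: (measurableT_comp measurable_S (pair1_measurable x)).
Qed.

End S_measurable.

(** * Tiling, overlap and transversality estimates *)

Lemma measurable_I01 (R : realType) : measurable (@I01 R).
Proof. exact: measurable_itv. Qed.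

(** The maps [x -> (x + a) / b] send [[0, 1)] onto the consecutive intervals [D a] that tile it, and
    each change of variables costs a factor [b]. The initial segments [D' a] allow the tiles to be
    joined one at a time. *)
Lemma ge0_integral_tile1 (R : realType) (b : nat) (h : R -> \bar R) : (0 < b)%N ->
  measurable_fun (@I01 R) h -> (forall x, I01 x -> 0 <= h x)%E ->
  (\int[lebesgue_measure]_(x in @I01 R) \sum_(a < b) h ((x + a%:R) / b%:R)%R =
   b%:R%:E * \int[lebesgue_measure]_(x in @I01 R) h x)%E.
Proof.
move=> b0 mh h0; have b0' : 0 < b%:R :> R by rewrite ltr0n.
pose D (a : nat) : set R := `[(a%:R / b%:R), (a.+1%:R / b%:R)[%classic.
pose D' (a : nat) : set R := `[0, (a%:R / b%:R)[%classic.
have mD a : measurable (D a) by exact: measurable_itv.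
have mD' a : measurable (D' a) by exact: measurable_itv.
have mI := @measurable_I01 R.
have DI (a : nat) : (a < b)%N -> D a `<=` @I01 R.
  move=> ab x; rewrite /D /I01 /= !in_itv/= => /andP[x1 x2].
  apply/andP; split; first by apply: le_trans x1; rewrite divr_ge0.
  by apply: (lt_le_trans x2); rewrite ler_pdivrMr// mul1r ler_nat.
have D'I (a : nat) : (a <= b)%N -> D' a `<=` @I01 R.
  move=> ab x; rewrite /D' /I01 /= !in_itv/= => /andP[-> x2] /=.
  by apply: (lt_le_trans x2); rewrite ler_pdivrMr// mul1r ler_nat.
have DE (a : nat) (x : R) :
    (a%:R / b%:R <= (x + a%:R) / b%:R < a.+1%:R / b%:R) = (0 <= x < 1).
  by rewrite ler_pM2r ?invr_gt0// ltr_pM2r ?invr_gt0// lerDr -natr1 addrC ltrD2l.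
have hD (a : 'I_b) : (\int[lebesgue_measure]_(x in @I01 R) h ((x + a%:R) / b%:R)%R =
    b%:R%:E * \int[lebesgue_measure]_(x in D a) h x)%E.
  have := @ge0_integral_affine R b%:R^-1 (a%:R / b%:R) (D a) h.
  rewrite invr_gt0 invrK => /(_ b0' _ _ _) <-//.
  - rewrite (_ : [set y | D a (b%:R^-1 * y + a%:R / b%:R)] = @I01 R).
      by apply: eq_integral => x _; rewrite mulrDl mulrC.
    apply/seteqP; split => x; rewrite /D /I01 /= !in_itv/=;
    by rewrite (_ : b%:R^-1 * x + a%:R / b%:R = (x + a%:R) / b%:R) ?DE// mulrDl mulrC.
  - by apply: measurable_funS mh => //; exact: DI.
  - by move=> y Dy; apply: h0; exact: (DI _ (ltn_ord a)).
have hD' (n : nat) : (n <= b)%N ->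
    (\sum_(a < n) \int[lebesgue_measure]_(x in D a) h x =
    \int[lebesgue_measure]_(x in D' n) h x)%E.
  elim: n => [_|n ih nb].
    by rewrite big_ord0 /D' mul0r set_itvco0 integral_set0.
  rewrite big_ord_recr/= ih ?(ltnW nb)// -ge0_integral_setU//=; [|exact: mD'|exact: mD|..].
  - congr (integral _ _ _); apply/seteqP; split => x; rewrite /D /D' /= !in_itv/=.
      case=> /andP[x1 x2]; apply/andP; split => //.
        by apply: (lt_le_trans x2); rewrite ler_pM2r ?invr_gt0// ler_nat.
      by apply: le_trans x1; rewrite divr_ge0.
    move=> /andP[x1 x2]; have [xn|nx] := ltP x (n%:R / b%:R).
      by left; rewrite x1.
    by right; rewrite x2.
  - apply: measurable_funS mh => //.
    by move=> x [/(D'I _ (ltnW nb))|/(DI _ nb)].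
  - by move=> x [/(D'I _ (ltnW nb))|/(DI _ nb)]; exact: h0.
  - apply/disj_set2P/seteqP; split => // x; rewrite /D /D' /= !in_itv/=.
    move=> -[/andP[_ x1] /andP[x2 _]].
    by move: (lt_le_trans x1 x2); rewrite ltxx.
rewrite ge0_integral_sum//.
- under eq_bigr do rewrite hD.
  rewrite -ge0_sume_distrr; last first.
    by move=> a _; apply: integral_ge0 => x Dx; apply: h0; exact: (DI a).
  by rewrite hD'// /D' divff ?gt_eqF.
- move=> a; apply: (@measurable_comp _ _ _ _ _ _ (@I01 R)) => //.
    move=> _ [x Ix <-]; apply: (DI _ (ltn_ord a)); move: Ix.
    by rewrite /D /I01 /= !in_itv/= DE.
  by apply: measurable_funM => //; exact: measurable_funD.
- move=> a x Ix; apply: h0; apply: (DI _ (ltn_ord a)); move: Ix.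
  by rewrite /D /I01 /= !in_itv/= DE.
Qed.

Lemma measurable_xu (R : realType) (b q : nat) (k : q.-tuple 'I_b) :
  measurable_fun setT (fun x : R => xu x k).
Proof. by apply: measurable_funM => //; exact: measurable_funD. Qed.

(** Invariance of Lebesgue measure under [x -> b^q x mod 1], in transfer-operator form. It turns
    energies at the points [xu x k] back into energies at [x]. *)
Lemma ge0_integral_tile (R : realType) (b q : nat) (h : R -> \bar R) : (2 <= b)%N ->
  measurable_fun (@I01 R) h -> (forall x, I01 x -> 0 <= h x)%E ->
  (\int[lebesgue_measure]_(x in @I01 R) \sum_(k : q.-tuple 'I_b) h (xu x k) =
   (b%:R ^+ q)%:E * \int[lebesgue_measure]_(x in @I01 R) h x)%E.
Proof.
move=> b2 mh h0; elim: q => [|q ih].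
  rewrite expr0 mul1e; apply: eq_integral => x _.
  rewrite (big_pred1 [tuple])/=; first by rewrite xu_nil.
  by move=> t; apply/esym/eqP; exact: tuple0.
have b0 : (0 < b)%N by exact: ltnW.
under eq_integral => x _.
  rewrite big_tuple_cons.
  under eq_bigr => a _ do under eq_bigr => k _ do rewrite xu_cons//.
  over.
rewrite (ge0_integral_tile1 (h := fun y => \sum_(k : q.-tuple 'I_b) h (xu y k)))//.
- by rewrite ih muleA -EFinM -exprS.
- apply: emeasurable_sum => k; apply: (@measurable_comp _ _ _ _ _ _ (@I01 R)) => //.
    exact: measurable_I01.
    by move=> _ [x Ix <-]; exact: xu_I01.
  exact: measurable_funTS (measurable_xu k).
- by move=> x Ix; apply: sume_ge0 => k _; apply: h0; exact: xu_I01.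
Qed.

Definition product_self d (T : measurableType d) (R : realType)
  (P : probability T R) : probability (T * T)%type R := (P \x P)%E.

Lemma product_selfE d (T : measurableType d) (R : realType)
    (P : probability T R) (A B : set T) : measurable A -> measurable B ->
  product_self P (A `*` B) = (P A * P B)%E.
Proof. exact: product_measure1E. Qed.

Section ball_overlap.
Context d (T : measurableType d) (R : realType) (P : probability T R).
Local Notation leb := (@lebesgue_measure R).
Variables (X Y : T -> R).
Hypotheses (mX : measurable_fun setT X) (mY : measurable_fun setT Y).

Let measurable_preimage_ball (Z : T -> R) (y r : R) : measurable_fun setT Z ->
  measurable (Z @^-1` ball y r).
Proof.
by move=> mZ; rewrite -[X in measurable X]setTI; apply: mZ => //; exact: measurable_ball.
Qed.

(** A point [y] within [r] of both values forces them to be within [2 r] of each other, and all such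
    [y] lie in one ball of length [2 r]. *)
Lemma ball_overlap (r : R) : 0 < r ->
  (\int[leb]_y (fine (P (X @^-1` ball y r)) * fine (P (Y @^-1` ball y r)))%:E <=
   (2 * r)%:E * product_self P [set w | (`|X w.1 - Y w.2| < 2 * r)%R])%E.
Proof.
move=> r0.
have mX1 : measurable_fun setT (fun w : T * T => X w.1).
  exact: (measurableT_comp mX measurable_fst).
have mY2 : measurable_fun setT (fun w : T * T => Y w.2).
  exact: (measurableT_comp mY measurable_snd).
pose Q := [set w : T * T | `|X w.1 - Y w.2| < 2 * r].
have mQ : measurable Q.
  apply: measurable_set_lt; apply: measurableT_comp => //.
  exact: measurable_funB.
pose A := [set p : R * (T * T) | `|p.1 - X p.2.1| < r] `&`
          [set p : R * (T * T) | `|p.1 - Y p.2.2| < r].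
have mA : measurable A.
  apply: measurableI; apply: measurable_set_lt; apply: measurableT_comp => //;
    apply: measurable_funB; (try exact: measurable_fst).
  - exact: (measurableT_comp mX1 measurable_snd).
  - exact: (measurableT_comp mY2 measurable_snd).
have -> : (\int[leb]_y (fine (P (X @^-1` ball y r)) * fine (P (Y @^-1` ball y r)))%:E =
    \int[leb]_y product_self P (xsection A y))%E.
  apply: eq_integral => y _.
  rewrite (_ : xsection A y = (X @^-1` ball y r) `*` (Y @^-1` ball y r)).
    rewrite product_selfE; [|exact: measurable_preimage_ball..].
    by rewrite EFinM !fineK// fin_num_measure//; exact: measurable_preimage_ball.
  by apply/seteqP; split => w; rewrite /xsection/= inE.
rewrite (fubini_sections leb (product_self P) mA).
apply: (@le_trans _ _ (\int[(product_self P)]_w ((2 * r)%:E * (\1_Q w)%:E))%E).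
  apply: ge0_le_integral => //.
  - exact: (measurable_fun_ysection leb mA).
  - by apply: measurable_funeM; apply/measurable_EFinP; exact: measurable_indic.
  move=> w _; rewrite indicE; have [wQ|wQ] := boolP (w \in Q).
    rewrite mule1; apply: (@le_trans _ _ (leb (ball (X w.1) r))).
      apply: le_measure; rewrite ?inE.
      + exact: measurable_ysection.
      + exact: measurable_ball.
      + by move=> y; rewrite /ysection/= inE => -[/= h _]; exact: ball_sym.
    by rewrite lebesgue_measure_ball ?(ltW r0)// mulr_natl.
  rewrite (_ : ysection A w = set0) ?measure0 ?mule0//.
  apply/seteqP; split => // y; rewrite /ysection/= inE => -[/= h1 h2].
  move/negP: wQ; apply; rewrite inE /Q/= -(subrKA y).
  by rewrite (le_lt_trans (ler_normD _ _))// mulr_natl mulr2n ltrD// distrC.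
rewrite ge0_integralZl_EFin; [|exact: measurableT|..]; last 3 first.
- by move=> w _; rewrite lee_fin.
- by apply/measurable_EFinP; exact: measurable_indic.
- by rewrite mulr_ge0// ltW.
by rewrite integral_indic// setIT.
Qed.

End ball_overlap.

(* On an interval of length [< d] containing a point of [Z], [g] expands distances
   by at least [del / 4], so [Z] meets it in a set of diameter [O(rho)]. *)
Lemma transversal_set_measure (R : realType) (d del h : R) :
  0 < d -> 0 < del -> 0 < h -> h < d ->
  exists2 C : R, 0 <= C & forall (g dg : R -> R) (rho : R) (Z : set R),
    (forall x y z, `|y - x| < d -> `|z - x| < d ->
       `|g y - g z - dg x * (y - z)| <= del / 4 * `|y - z|) ->
    measurable Z -> 0 < rho ->
    (forall x, Z x -> [/\ I01 x, `|g x| < rho &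
       3 / 4 * del * h < `|g (x + h) - g x|]) ->
    (lebesgue_measure Z <= (C * rho)%:E)%E.
Proof.
move=> d0 del0 h0 hd.
pose N := (Num.truncn d^-1).+1.
have N0 : 0 < N%:R :> R by rewrite ltr0n.
have Nd : N%:R^-1 < d by rewrite invf_plt ?posrE//; exact: truncnS_gt.
(* Each of the [N] intervals of length [1 / N < d] will contribute a ball of radius
   [8 rho / del]. *)
exists (N%:R * (16 / del)); first by rewrite mulr_ge0 ?divr_ge0 ?ltW.
move=> g dg rho Z gdg mZ rho0 hZ.
pose I k : set R := Z `&` `[(k%:R / N%:R), (k.+1%:R / N%:R)[%classic.
have mI k : measurable (I k) by exact: measurableI.
have ZI : Z `<=` \big[setU/set0]_(k < N) I k.
  move=> x Zx; have [] := hZ x Zx; rewrite /I01/= in_itv/= => /andP[x0 x1] _ _.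
  have xN0 : 0 <= x * N%:R by rewrite mulr_ge0// ltW.
  have /andP[k1 k2] := truncn_itv xN0.
  have kN : (Num.truncn (x * N%:R) < N)%N.
    by rewrite -(ltr_nat R) (le_lt_trans k1)// gtr_pMl.
  rewrite -bigcup_mkord; exists (Num.truncn (x * N%:R)) => //.
  split => //=; rewrite in_itv/=.
  by rewrite ler_pdivrMr// k1 ltr_pdivlMr.
have := @content_subadditive _ _ _ (@lebesgue_measure R) Z I N (fun k _ => mI k) mZ ZI.
move=> /le_trans; apply.
apply: (@le_trans _ _ (\sum_(k < N) ((16 / del * rho)%:E : \bar R))%E); last first.
  rewrite sumEFin sumr_const card_ord.
  by rewrite -[16 / del * rho *+ N]mulr_natl mulrA.
apply: lee_sum => k _.
have [->|/set0P[x0 [Zx0 Ix0]]] := eqVneq (I k) set0.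
  by rewrite measure0 lee_fin mulr_ge0 ?divr_ge0 ?ltW.
apply: (@le_trans _ _ (lebesgue_measure (ball x0 (8 / del * rho)))); last first.
  have p0 : 0 <= 8 / del * rho by rewrite mulr_ge0 ?divr_ge0 ?(ltW del0) ?(ltW rho0).
  rewrite lebesgue_measure_ball// lee_fin le_eqVlt; apply/orP; left; apply/eqP.
  by field; rewrite gt_eqF.
apply: le_measure; rewrite ?inE; [exact: mI|exact: measurable_ball|].
move=> y [Zy Iy]; rewrite /ball/=.
have [_ gx hx] := hZ _ Zx0; have [_ gy _] := hZ _ Zy.
have yx : `|y - x0| < d.
  apply: lt_trans Nd; move: Ix0 Iy; rewrite /= !in_itv/= -!natr1 !mulrDl mul1r.
  by rewrite ltr_norml => /andP[? ?] /andP[? ?]; apply/andP; split; lra.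
have x0d : `|x0 - x0| < d by rewrite subrr normr0.
have hd' : `|x0 + h - x0| < d by rewrite addrAC subrr add0r gtr0_norm.
have h1 := gdg x0 (x0 + h) x0 hd' x0d.
have h2 := gdg x0 y x0 yx x0d.
(* The difference quotient exceeds [3/4 del] and is within [del / 4] of [dg x0]. *)
have dgx : del / 2 < `|dg x0|.
  have e1 : x0 + h - x0 = h by rewrite addrAC subrr add0r.
  rewrite e1 (gtr0_norm h0) in h1.
  have h3 : `|g (x0 + h) - g x0| <= del / 4 * h + `|dg x0| * h.
    rewrite -[X in _ <= _ + X]/(`|dg x0| * h) -{3}(gtr0_norm h0) -normrM.
    by rewrite -lerBlDr (le_trans _ h1)// lerB_dist.
  have := lt_le_trans hx h3; rewrite -mulrDl ltr_pM2r//; lra.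
have h4 : `|dg x0| * `|y - x0| <= 2 * rho + del / 4 * `|y - x0|.
  rewrite -normrM.
  have -> : dg x0 * (y - x0) = (g y - g x0) - (g y - g x0 - dg x0 * (y - x0)) by ring.
  apply: (le_trans (ler_normB _ _)); apply: lerD => //.
  by apply: (le_trans (ler_normB _ _)); lra.
(* The slope exceeds [del / 2], the linear approximation loses [del / 4] of it, and the two values
   of [g] differ by less than [2 rho]. *)
have h5 : del / 4 * `|y - x0| < 2 * rho.
  have [->|yx0] := eqVneq y x0; first by rewrite subrr normr0 mulr0 mulr_gt0.
  have p0 : 0 < `|y - x0| by rewrite normr_gt0 subr_eq0.
  have h6 : del / 2 * `|y - x0| < `|dg x0| * `|y - x0| by rewrite ltr_pM2r.
  lra.
rewrite distrC (_ : 8 / del * rho = (2 * rho) / (del / 4)); last first.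
  by field; rewrite gt_eqF.
by rewrite ltr_pdivlMr ?divr_gt0// mulrC.
Qed.

(** * Energy of the fibre measures *)

Section energy.
Variables (R : realType) (b : nat) (gamma : R) (psi : R -> R).
Hypothesis b_ge2 : (2 <= b)%N.
Hypothesis gamma01 : 0 < gamma < 1.
Hypothesis psi_periodic : forall x : R, psi (x + 1) = psi x.
Hypothesis psi_derivable : forall x : R, derivable psi x 1.
Local Notation Om := (SeqSpace (ltnW b_ge2)).
Local Notation leb := (@lebesgue_measure R).
Variable P : probability Om R.
Hypothesis P_uniform : uniform_bernoulli P.

Definition ball_mass (r x y : R) : R := fine (mx gamma psi P x (ball y r)).

(* Tsujii's [||m_x||_r^2]. *)
Definition ball_energy (r x : R) : \bar R := (\int[leb]_y (ball_mass r x y ^+ 2)%:E)%E.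

Let mS : measurable_fun setT (fun p : R * Om => S gamma psi p.1 p.2).
Proof. exact: measurable_S. Qed.

Let mSx (x : R) : measurable_fun setT (fun i : Om => S gamma psi x i).
Proof. exact: measurable_Sx. Qed.

Lemma measurable_Sx_ball (x y r : R) :
  measurable ((fun i : Om => S gamma psi x i) @^-1` ball y r).
Proof.
by rewrite -[X in measurable X]setTI; apply: mSx => //; exact: measurable_ball.
Qed.

Lemma ball_massE (r x y : R) : (ball_mass r x y)%:E = mx gamma psi P x (ball y r).
Proof. by rewrite fineK// fin_num_measure//; exact: measurable_Sx_ball. Qed.

Lemma ball_mass_ge0 (r x y : R) : 0 <= ball_mass r x y.
Proof. by apply: fine_ge0; exact: measure_ge0. Qed.

Lemma measurable_mx_ball (r : R) :
  measurable_fun setT (fun p : R * R => mx gamma psi P p.1 (ball p.2 r)).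
Proof.
pose A := [set p : (R * R) * Om | `|p.1.2 - S gamma psi p.1.1 p.2| < r].
have mA : measurable A.
  apply: measurable_set_lt; apply: measurableT_comp => //.
  apply: measurable_funB.
    exact: (measurableT_comp measurable_snd measurable_fst).
  apply: (measurableT_comp (f := fun p : R * Om => S gamma psi p.1 p.2)
    (g := fun p : (R * R) * Om => (p.1.1, p.2))) => //.
  apply: measurable_fun_pair; last exact: measurable_snd.
  exact: (measurableT_comp measurable_fst measurable_fst).
have := measurable_fun_xsection P mA.
congr (measurable_fun _ _); apply/funext => p /=; rewrite /mx; congr (P _).
by apply/seteqP; split => i; rewrite /xsection/= inE.
Qed.

Lemma measurable_ball_mass (r : R) :
  measurable_fun setT (fun p : R * R => ball_mass r p.1 p.2).
Proof.
by apply: measurableT_comp; [exact: fine_measurable|exact: measurable_mx_ball].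
Qed.

Lemma measurable_ball_mass_y (r x : R) : measurable_fun setT (ball_mass r x).
Proof. exact: (measurableT_comp (measurable_ball_mass r) (pair1_measurable x)). Qed.

Lemma ball_energy_ge0 r x : (0 <= ball_energy r x)%E.
Proof. by apply: integral_ge0 => y _; rewrite lee_fin sqr_ge0. Qed.

Lemma measurable_ball_energy (r : R) : measurable_fun setT (ball_energy r).
Proof.
apply: (measurable_fun_fubini_tonelli_F (m2 := leb)
  (fun p : R * R => (ball_mass r p.1 p.2 ^+ 2)%:E)).
- by apply/measurable_EFinP; apply: measurable_funX; exact: measurable_ball_mass.
- by move=> p; rewrite lee_fin sqr_ge0.
Qed.

(** This crude bound starts the induction over the radii. *)
Lemma ball_energy_le (r x : R) : 0 < r -> (ball_energy r x <= (2 * r)%:E)%E.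
Proof.
move=> r0; apply: (le_trans (ball_overlap P (mSx x) (mSx x) r0)).
rewrite -[leRHS]mule1; apply: lee_wpmul2l; first by rewrite lee_fin mulr_ge0// ltW.
apply: probability_le1; apply: measurable_set_lt; apply: measurableT_comp => //.
apply: measurable_funB.
- exact: (measurableT_comp (mSx x) measurable_fst).
- exact: (measurableT_comp (mSx x) measurable_snd).
Qed.

Section order_q.
Variable q : nat.
Local Notation U := (q.-tuple 'I_b).

Definition branch_mass (k : U) (r x y : R) : R :=
  fine (P ((fun i : Om => S gamma psi x (concat k i)) @^-1` ball y r)).

Let mSk (k : U) : measurable_fun setT (fun p : R * Om => S gamma psi p.1 (concat k p.2)).
Proof.
apply: (measurableT_comp (f := fun p : R * Om => S gamma psi p.1 p.2)
    (g := fun p : R * Om => (p.1, concat k p.2))) => //.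
apply: measurable_fun_pair; first exact: measurable_fst.
apply: (measurableT_comp (f := concat k : Om -> Om)); last exact: measurable_snd.
exact: measurable_concat.
Qed.

Let mSkx (k : U) (x : R) : measurable_fun setT (fun i : Om => S gamma psi x (concat k i)).
Proof. exact: (measurableT_comp (mSk k) (pair1_measurable x)). Qed.

Lemma branch_mass_ge0 (k : U) (r x y : R) : 0 <= branch_mass k r x y.
Proof. by apply: fine_ge0; exact: measure_ge0. Qed.

Lemma ball_mass_branch (r x y : R) :
  ball_mass r x y = b%:R ^- q * \sum_(k : U) branch_mass k r x y.
Proof.
apply: EFin_inj; rewrite ball_massE /mx.
rewrite (bernoulli_concat P_uniform q (measurable_Sx_ball x y r)) EFinM.
congr (_ * _)%E; rewrite -sumEFin; apply: eq_bigr => k _.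
rewrite fineK// fin_num_measure// -[X in measurable X]setTI.
by apply: mSkx => //; exact: measurable_ball.
Qed.

(** By [S_concat], the law of a branch is an affine image, of ratio [gamma ^+ q], of the fibre
    measure at [xu x k]; balls pull back to balls of radius [r / gamma ^+ q]. *)
Lemma branch_massE (k : U) (x : R) : exists c : R, forall r y,
  branch_mass k r x y =
  ball_mass (r / gamma ^+ q) (xu x k) ((gamma ^+ q)^-1 * y + c).
Proof.
have /andP[g0 _] := gamma01.
have [c cP] := S_concat b_ge2 gamma01 psi_periodic psi_derivable k x.
exists (- c / gamma ^+ q) => r y; rewrite /branch_mass /ball_mass /mx.
congr (fine (P _)); apply/seteqP; split => i;
rewrite /ball/= cP; set s := S _ _ _ i;
have -> : (gamma ^+ q)^-1 * y + - c / gamma ^+ q - s =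
  (y - (c + gamma ^+ q * s)) / gamma ^+ q
  by field; rewrite expf_neq0// gt_eqF.
- by rewrite normrM normfV (gtr0_norm (exprn_gt0 _ g0)) ltr_pM2r// invr_gt0 exprn_gt0.
- by rewrite normrM normfV (gtr0_norm (exprn_gt0 _ g0)) ltr_pM2r// invr_gt0 exprn_gt0.
Qed.

Lemma measurable_branch_mass (k : U) (r x : R) : measurable_fun setT (branch_mass k r x).
Proof.
have [c cP] := branch_massE k x.
rewrite (_ : branch_mass k r x = ball_mass (r / gamma ^+ q) (xu x k) \o
  (fun y => (gamma ^+ q)^-1 * y + c)); last by apply/funext => y /=; exact: cP.
apply: measurableT_comp; first exact: measurable_ball_mass_y.
exact: measurable_affine.
Qed.

Lemma branch_energy (k : U) (r x : R) :
  (\int[leb]_y (branch_mass k r x y ^+ 2)%:E =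
   (gamma ^+ q)%:E * ball_energy (r / gamma ^+ q) (xu x k))%E.
Proof.
have /andP[g0 _] := gamma01.
have [c cP] := branch_massE k x.
under eq_integral do rewrite cP.
have := @ge0_integral_affine R (gamma ^+ q)^-1 c setT
  (fun y => (ball_mass (r / gamma ^+ q) (xu x k) y ^+ 2)%:E).
rewrite invr_gt0 exprn_gt0// invrK => /(_ isT measurableT) <-.
- by congr (integral _ _ _); apply/seteqP; split.
- by apply/measurable_EFinP; apply: measurable_funX; exact: measurable_ball_mass_y.
- by move=> y _; rewrite lee_fin sqr_ge0.
Qed.

Variables (V : R -> U -> U -> R) (eps del h d : R).
Hypothesis V_ge0 : forall x u v, I01 x -> 0 <= V x u v.
Hypothesis V_adm : forall x, I01 x -> forall u v,
  Eset gamma psi x eps del (u, v) -> 1 <= V x u v * V x v u.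
Hypotheses (eps_gt0 : 0 < eps) (del_gt0 : 0 < del) (h_gt0 : 0 < h) (h_lt : h < d).
Hypothesis S_strong : forall (i : seqA b) x y z,
  `|y - x| < d -> `|z - x| < d ->
  `|S gamma psi y i - S gamma psi z i - S' gamma psi x i * (y - z)| <= del / 8 * `|y - z|.

Definition branch_gap (p : U * U) (x : R) (w : Om * Om) : R :=
  S gamma psi x (concat p.1 w.1) - S gamma psi x (concat p.2 w.2).

(* The derivative condition of transversality, [del < `|branch_gap' x|], is
   replaced by one on the difference quotient of step [h]. *)
Definition transversal (p : U * U) (r x : R) : set (Om * Om) :=
  [set w | `|branch_gap p x w| < 2 * r /\
     3 / 4 * del * h < `|branch_gap p (x + h) w - branch_gap p x w|].

(** Each of the two branches has error [del / 8], which together make the [del / 4] required by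
    [transversal_set_measure]. *)
Let gap_strong (p : U * U) (w : Om * Om) x y z : `|y - x| < d -> `|z - x| < d ->
  `|branch_gap p y w - branch_gap p z w -
    (S' gamma psi x (concat p.1 w.1) - S' gamma psi x (concat p.2 w.2)) * (y - z)|
  <= del / 4 * `|y - z|.
Proof.
move=> yx zx; rewrite /branch_gap.
set s1 := S' _ _ _ _; set s2 := S' _ _ _ _.
have h1 := S_strong (concat p.1 w.1) yx zx.
have h2 := S_strong (concat p.2 w.2) yx zx.
rewrite -/s1 in h1; rewrite -/s2 in h2.
set a1 := S _ _ y _ in h1 *; set a2 := S _ _ z (concat p.1 _) in h1 *.
set a3 := S _ _ y _ in h2 *; set a4 := S _ _ z _ in h2 *.
have -> : a1 - a3 - (a2 - a4) - (s1 - s2) * (y - z) =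
  (a1 - a2 - s1 * (y - z)) - (a3 - a4 - s2 * (y - z)) by ring.
apply: (le_trans (ler_normB _ _)); apply: (le_trans (lerD h1 h2)).
by rewrite -mulrDl (_ : del / 8 + del / 8 = del / 4)//; field.
Qed.

Let measurable_gap (p : U * U) (t : R) :
  measurable_fun setT (fun z : R * (Om * Om) => branch_gap p (z.1 + t) z.2).
Proof.
have mt : measurable_fun setT (fun z : R * (Om * Om) => z.1 + t).
  by apply: measurable_funD => //; exact: measurable_fst.
apply: measurable_funB.
- apply: (measurableT_comp (f := fun z : R * Om => S gamma psi z.1 (concat p.1 z.2))
    (g := fun z : R * (Om * Om) => (z.1 + t, z.2.1))) => //.
  apply: measurable_fun_pair => //.
  exact: (measurableT_comp measurable_fst measurable_snd).
- apply: (measurableT_comp (f := fun z : R * Om => S gamma psi z.1 (concat p.2 z.2))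
    (g := fun z : R * (Om * Om) => (z.1 + t, z.2.2))) => //.
  apply: measurable_fun_pair => //.
  exact: (measurableT_comp measurable_snd measurable_snd).
Qed.

Let transversal_graph (p : U * U) (r : R) : set (R * (Om * Om)) :=
  [set z | `|branch_gap p z.1 z.2| < 2 * r] `&`
  [set z | 3 / 4 * del * h < `|branch_gap p (z.1 + h) z.2 - branch_gap p z.1 z.2|].

Let measurable_transversal_graph p r : measurable (transversal_graph p r).
Proof.
have m0 : measurable_fun setT (fun z : R * (Om * Om) => branch_gap p z.1 z.2).
  have := measurable_gap p 0; congr (measurable_fun _ _).
  by apply/funext => z; rewrite addr0.
apply: measurableI.
  by apply: measurable_set_lt; apply: measurableT_comp.
apply: measurable_set_gt; apply: measurableT_comp => //.
by apply: measurable_funB => //; exact: measurable_gap.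
Qed.

Let transversal_xsection p r x : transversal p r x = xsection (transversal_graph p r) x.
Proof. by apply/seteqP; split => w; rewrite /xsection/= inE. Qed.

Lemma measurable_transversal (p : U * U) (r x : R) : measurable (transversal p r x).
Proof. by rewrite transversal_xsection; exact: measurable_xsection. Qed.

Lemma measurable_transversal_mass (p : U * U) (r : R) :
  measurable_fun setT (fun x : R => product_self P (transversal p r x)).
Proof.
have := measurable_fun_xsection (product_self P) (measurable_transversal_graph p r).
by congr (measurable_fun _ _); apply/funext => x /=; rewrite transversal_xsection.
Qed.

(** After exchanging the integrals, [w] is fixed and [transversal_set_measure] bounds the set of [x]
    by a constant independent of [w]; the measure in [w] has total mass one. *)
Lemma transversal_mass : exists2 C : R, 0 <= C & forall (p : U * U) (r : R), 0 < r ->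
  (\int[leb]_(x in @I01 R) product_self P (transversal p r x) <= (C * r)%:E)%E.
Proof.
have d0 : 0 < d by exact: lt_trans h_lt.
have [C C0 hC] := transversal_set_measure d0 del_gt0 h_gt0 h_lt.
exists (C * 2); first by rewrite mulr_ge0.
move=> p r r0.
pose A := transversal_graph p r `&` (@I01 R `*` setT).
have mA : measurable A.
  apply: measurableI => //; apply: measurableX => //; exact: measurable_I01.
have -> : (\int[leb]_(x in @I01 R) product_self P (transversal p r x) =
    \int[leb]_x product_self P (xsection A x))%E.
  rewrite integral_mkcond; apply: eq_integral => x _; rewrite patchE.
  case: ifPn => Ix.
    congr (product_self P _); apply/seteqP; split => w; rewrite /xsection/= inE.
      by move=> [w1 w2]; split => //; split => //; exact: set_mem.
    by case.
  rewrite (_ : xsection A x = set0) ?measure0//.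
  apply/seteqP; split => // w; rewrite /xsection/= inE => -[_ [/= Ix' _]].
  by move/negP: Ix; apply; rewrite inE.
rewrite (fubini_sections leb (product_self P) mA).
apply: (@le_trans _ _ (\int[product_self P]_w (C * (2 * r))%:E)%E).
  apply: ge0_le_integral => //.
  - exact: (measurable_fun_ysection leb mA).
  move=> w _.
  apply: (@hC (fun x => branch_gap p x w)
    (fun x => S' gamma psi x (concat p.1 w.1) - S' gamma psi x (concat p.2 w.2))) => //.
  - by move=> x y z; exact: gap_strong.
  - exact: measurable_ysection.
  - by rewrite mulr_gt0.
  - by move=> x; rewrite /ysection/= inE => -[[/= h1 h2] [/= Ix _]].
rewrite integral_cst// [X in (_ * X)%E](_ : _ = 1%E) ?mule1 ?lee_fin ?mulrA//.
exact: probability_setT.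
Qed.

Lemma energy_pointwise (r x : R) : 0 < r -> 2 * r <= eps -> I01 x ->
  (ball_energy r x <= ((b%:R ^- q) ^+ 2)%:E *
    (\sum_(u : U) ((gamma ^+ q * \sum_(v : U) V x u v)%:E *
        ball_energy (r / gamma ^+ q) (xu x u)) +
     \sum_(p : U * U) ((2 * r)%:E * product_self P (transversal p r x))))%E.
Proof.
move=> r0 reps Ix; have /andP[g0 _] := gamma01.
pose G u y := branch_mass u r x y.
have G0 u y : 0 <= G u y by exact: branch_mass_ge0.
have mG u : measurable_fun setT (G u) by exact: measurable_branch_mass.
(* Indicator of the pairs left to transversality. *)
pose e (p : U * U) : R := if pselect (Eset gamma psi x eps del p) then 0 else 1.
have e0 p : 0 <= e p by rewrite /e; case: pselect.
pose a u := \sum_(v : U) V x u v.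
have a0 u : 0 <= a u by apply: sumr_ge0 => v _; exact: V_ge0.
have ptw y : ball_mass r x y ^+ 2 <= (b%:R ^- q) ^+ 2 *
    (\sum_(u : U) a u * G u y ^+ 2 + \sum_(p : U * U) e p * (G p.1 y * G p.2 y)).
  rewrite ball_mass_branch exprMn ler_wpM2l ?sqr_ge0//.
  rewrite expr2 mulr_suml.
  under eq_bigr do rewrite mulr_sumr.
  rewrite pair_bigA/=.
  (* AM-GM, using [V x u v * V x v u >= 1] on [Eset] *)
  have key (p : U * U) : G p.1 y * G p.2 y <=
      2^-1 * (V x p.1 p.2 * G p.1 y ^+ 2) + 2^-1 * (V x p.2 p.1 * G p.2 y ^+ 2) +
      e p * (G p.1 y * G p.2 y).
    case: p => u v /=; rewrite /e; case: pselect => E; last first.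
      rewrite mul1r lerDr addr_ge0// mulr_ge0 ?invr_ge0// mulr_ge0 ?sqr_ge0//;
      exact: V_ge0.
    rewrite mul0r addr0 -mulrDr ler_pdivlMl//.
    have V1 := V_ge0 u v Ix; have V2 := V_ge0 v u Ix; have V3 := V_adm Ix E.
    set s := V x u v in V1 V3 *; set t := V x v u in V2 V3 *.
    have s0 : 0 < s.
      rewrite lt_neqAle V1 andbT; apply/negP => /eqP s0.
      by move: V3; rewrite -s0 mul0r ler10.
    (* Multiplying by [s] avoids division: the difference becomes a square plus a multiple of
       [s * t - 1], which is nonnegative by admissibility. *)
    rewrite -(ler_pM2l s0) -subr_ge0.
    have -> : s * (s * G u y ^+ 2 + t * G v y ^+ 2) - s * (2 * (G u y * G v y)) =
      (s * G u y - G v y) ^+ 2 + (s * t - 1) * G v y ^+ 2 by ring.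
    by rewrite addr_ge0 ?sqr_ge0// mulr_ge0 ?sqr_ge0// subr_ge0.
  apply: (le_trans (ler_sum _ (fun p _ => key p))).
  rewrite !big_split/= -!mulr_sumr lerD2r.
  have -> : \sum_(p : U * U) V x p.1 p.2 * G p.1 y ^+ 2 = \sum_u a u * G u y ^+ 2.
    rewrite -(pair_bigA _ (fun u v => V x u v * G u y ^+ 2))/=.
    by apply: eq_bigr => u _; rewrite /a mulr_suml.
  have -> : \sum_(p : U * U) V x p.2 p.1 * G p.2 y ^+ 2 = \sum_u a u * G u y ^+ 2.
    rewrite -(pair_bigA _ (fun u v => V x v u * G v y ^+ 2))/= exchange_big/=.
    by apply: eq_bigr => u _; rewrite /a mulr_suml.
  by rewrite -mulrDl (_ : 2^-1 + 2^-1 = 1) ?mul1r//; lra.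
pose A1 u y : \bar R := ((a u)%:E * (G u y ^+ 2)%:E)%E.
pose A2 (p : U * U) y : \bar R := ((e p)%:E * (G p.1 y * G p.2 y)%:E)%E.
have A10 u y : (0 <= A1 u y)%E by rewrite mule_ge0// lee_fin// sqr_ge0.
have A20 p y : (0 <= A2 p y)%E by rewrite mule_ge0// lee_fin// mulr_ge0.
have mA1 u : measurable_fun setT (A1 u).
  by apply: measurable_funeM; apply/measurable_EFinP; exact: measurable_funX.
have mA2 p : measurable_fun setT (A2 p).
  by apply: measurable_funeM; apply/measurable_EFinP; exact: measurable_funM.
have s10 y : (0 <= \sum_u A1 u y)%E by exact: sume_ge0.
have s20 y : (0 <= \sum_p A2 p y)%E by exact: sume_ge0.
have ms1 : measurable_fun setT (fun y => \sum_u A1 u y)%E by exact: emeasurable_sum.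
have ms2 : measurable_fun setT (fun y => \sum_p A2 p y)%E by exact: emeasurable_sum.
apply: (@le_trans _ _ (\int[leb]_y (((b%:R ^- q) ^+ 2)%:E *
    (\sum_u A1 u y + \sum_p A2 p y)))%E).
  apply: ge0_le_integral => //.
  - by move=> y _; rewrite lee_fin sqr_ge0.
  - by apply/measurable_EFinP; apply: measurable_funX; exact: measurable_ball_mass_y.
  - by apply: measurable_funeM; exact: emeasurable_funD.
  move=> y _; rewrite /A1 /A2.
  under eq_bigr do rewrite -EFinM.
  under [X in (_ <= _ * (_ + X))%E]eq_bigr do rewrite -EFinM.
  rewrite !sumEFin.
  have := ptw y; by rewrite -lee_fin.
rewrite ge0_integralZl_EFin; [|exact: measurableT|..]; last 3 first.
- by move=> y _; rewrite adde_ge0.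
- exact: emeasurable_funD.
- exact: sqr_ge0.
apply: lee_wpmul2l; first by rewrite lee_fin sqr_ge0.
rewrite ge0_integralD// !ge0_integral_sum//.
apply: leeD; apply: lee_sum.
  move=> u _; rewrite /A1 ge0_integralZl_EFin//.
  - by rewrite branch_energy muleA -EFinM mulrC.
  - by move=> y _; rewrite lee_fin sqr_ge0.
  - by apply/measurable_EFinP; apply: measurable_funX; exact: mG.
move=> p _; rewrite /A2 ge0_integralZl_EFin//; last 2 first.
- by move=> y _; rewrite lee_fin mulr_ge0.
- by apply/measurable_EFinP; apply: measurable_funM; exact: mG.
rewrite /e; case: pselect => [E|nE] /=.
  by rewrite mul0e mule_ge0// lee_fin mulr_ge0// ltW.
rewrite mul1e.
apply: (le_trans (ball_overlap P (mSkx p.1 x) (mSkx p.2 x) r0)).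
apply: lee_wpmul2l; first by rewrite lee_fin mulr_ge0// ltW.
apply: le_measure; rewrite ?inE.
- apply: measurable_set_lt; apply: measurableT_comp => //.
  apply: measurable_funB.
    exact: (measurableT_comp (mSkx p.1 x) measurable_fst).
  exact: (measurableT_comp (mSkx p.2 x) measurable_snd).
- exact: measurable_transversal.
(* Since [2 * r <= eps], overlapping branches satisfy the first half of tangency. The pair is
   outside [Eset], so the derivative half must fail; a small increment over the step [h] would
   contradict this. *)
move=> w /= wr; split => //.
rewrite ltNge; apply/negP => hle; apply: nE.
exists w.1, w.2; split; first by rewrite (le_trans (ltW wr)).
set D := (X in `|X|).
have xd : `|x - x| < d by rewrite subrr normr0 (lt_trans h_gt0).
have xhd : `|x + h - x| < d by rewrite addrAC subrr add0r gtr0_norm.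
have := gap_strong p w xhd xd; rewrite -/D.
have -> : x + h - x = h by rewrite addrAC subrr add0r.
rewrite (gtr0_norm h_gt0) => hD.
(* The threshold [3/4 del] is what remains of [del] after the approximation error [del / 4]. *)
have : `|D| * h <= del / 4 * h + 3 / 4 * del * h.
  rewrite -{1}(gtr0_norm h_gt0) -normrM.
  have -> : D * h = (branch_gap p (x + h) w - branch_gap p x w) -
    (branch_gap p (x + h) w - branch_gap p x w - D * h) by ring.
  by apply: (le_trans (ler_normB _ _)); lra.
by rewrite -mulrDl ler_pM2r//; lra.
Qed.

End order_q.
End energy.

(** * Recursion for the weighted energy *)

Lemma lebesgue_measure_I01 (R : realType) : lebesgue_measure (@I01 R) = 1%E.
Proof. by rewrite /I01 lebesgue_measure_itv/= lte_fin ltr01 -EFinD subr0. Qed.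

Section energy_recursion.
Variables (R : realType) (b : nat) (gamma : R) (psi : R -> R).
Hypothesis b_ge2 : (2 <= b)%N.
Hypothesis gamma01 : 0 < gamma < 1.
Hypothesis psi_periodic : forall x : R, psi (x + 1) = psi x.
Hypothesis psi_derivable : forall x : R, derivable psi x 1.
Hypothesis psi'_continuous : continuous (derive1 psi).
Local Notation Om := (SeqSpace (ltnW b_ge2)).
Local Notation leb := (@lebesgue_measure R).
Variable P : probability Om R.
Hypothesis P_uniform : uniform_bernoulli P.
Variable q : nat.
Local Notation U := (q.-tuple 'I_b).
Local Notation energy := (ball_energy gamma psi P).

Variables (V : R -> U -> U -> R) (w : R -> R) (W M beta : R).
Hypothesis V_test : testing_function V.
Hypothesis V_adm : admissible gamma psi V.
Hypothesis mw : measurable_fun (@I01 R) w.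
Hypothesis w_gt0 : forall x, I01 x -> 0 < w x.
Hypothesis w_le : {ae leb, forall x, I01 x -> w x <= W}.
Hypothesis winv_le : {ae leb, forall x, I01 x -> (w x)^-1 <= M}.
Hypothesis Sigma_le : {ae leb, forall x, I01 x -> SigmaVw V w x <= beta}.
Hypotheses (W_ge0 : 0 <= W) (M_ge0 : 0 <= M) (beta_ge0 : 0 <= beta).
Hypothesis beta_lt : beta < (gamma * b%:R) ^+ q.

Definition weighted_energy (r : R) : \bar R :=
  (\int[leb]_(x in @I01 R) ((w x)%:E * energy r x))%E.

Let g0 : 0 < gamma. Proof. by case/andP: gamma01. Qed.
Let b0 : 0 < b%:R :> R. Proof. by rewrite ltr0n; exact: ltnW. Qed.
Let mE (r : R) : measurable_fun (@I01 R) (energy r).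
Proof. by apply: measurable_funTS; exact: measurable_ball_energy. Qed.
Let mwE : measurable_fun (@I01 R) (EFin \o w).
Proof. exact/measurable_EFinP. Qed.
Let mwEr (r : R) : measurable_fun (@I01 R) (fun x => (w x)%:E * energy r x)%E.
Proof. exact: emeasurable_funM. Qed.
Let wE0 r x : I01 x -> (0 <= (w x)%:E * energy r x)%E.
Proof.
by move=> Ix; apply: mule_ge0; [rewrite lee_fin ltW// w_gt0|exact: ball_energy_ge0].
Qed.
Let mI := @measurable_I01 R.

Lemma weighted_energy_le (r : R) : 0 < r -> (weighted_energy r <= (W * (2 * r))%:E)%E.
Proof.
move=> r0; apply: (@le_trans _ _ (\int[leb]_(x in @I01 R) (W * (2 * r))%:E)%E).
  apply: ae_ge0_le_integral => //.
  - by move=> x Ix; exact: wE0.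
  - exact: mwEr.
  - by move=> x _; rewrite lee_fin mulr_ge0// mulr_ge0// ltW.
  apply: ae_mono w_le => x wW Ix; rewrite EFinM.
  apply: lee_pmul; [by rewrite lee_fin ltW// w_gt0|exact: ball_energy_ge0| |].
    by rewrite lee_fin wW.
  exact: ball_energy_le.
rewrite integral_cst// [X in (_ * X)%E](_ : _ = 1%E) ?mule1//.
exact: lebesgue_measure_I01.
Qed.

Lemma energy_le_weighted (r : R) :
  (\int[leb]_(x in @I01 R) energy r x <= M%:E * weighted_energy r)%E.
Proof.
rewrite /weighted_energy -ge0_integralZl_EFin;
  [|exact: mI|by move=> x Ix; exact: wE0|exact: mwEr|exact: M_ge0].
apply: ae_ge0_le_integral => //.
- by move=> x _; exact: ball_energy_ge0.
- exact: mE.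
- by move=> x Ix; rewrite mule_ge0// wE0.
- by apply: measurable_funeM; exact: mwEr.
apply: ae_mono winv_le => x wM Ix; rewrite muleA -EFinM.
rewrite -[leLHS]mul1e; apply: lee_wpmul2r; first exact: ball_energy_ge0.
by rewrite lee_fin -ler_pdivrMr ?w_gt0// mul1r wM.
Qed.

(** Clearing the denominator of [SigmaVw] moves the weight from [x] to the branch point where the
    energy is evaluated. *)
Lemma Sigma_weight (x : R) (u : U) : I01 x -> SigmaVw V w x <= beta ->
  w x * \sum_(v : U) V x u v <= beta * w (xu x u).
Proof.
move=> Ix; have wx : 0 < w (xu x u) by apply: w_gt0; exact: xu_I01.
rewrite -ler_pdivrMr// mulrAC => hS; apply: le_trans hS.
exact: (le_bigmax _ (fun u : U => w x / w (xu x u) * \sum_(v : U) V x u v)).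
Qed.

Lemma energy_step : exists eps : R, exists C : R, [/\ 0 < eps, 0 <= C &
  forall r : R, 0 < r -> 2 * r <= eps ->
  (weighted_energy r <= ((b%:R ^- q) ^+ 2)%:E *
    ((beta * gamma ^+ q * b%:R ^+ q)%:E * weighted_energy (r / gamma ^+ q) +
     (C * r ^+ 2)%:E))%E].
Proof.
have [eps [del [eps0 [del0 V_eps]]]] := V_adm.
have [mV V_ge0] := V_test.
have [d d0 S_strong] := S_strong_derivative b_ge2 gamma01 psi_periodic
  psi_derivable psi'_continuous (divr_gt0 del0 (ltr0Sn R 7)).
pose h := d / 2.
have h0 : 0 < h by rewrite divr_gt0.
have hd : h < d by rewrite /h ltr_pdivrMr// ltr_pMr// ltr1n.
have [C C0 hC] := transversal_mass gamma01 psi_periodic psi_derivable P q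
  del0 h0 hd S_strong.
(* Each pair gives [2 r] from the overlap, at most [W] from the weight and [C r] from
   transversality, hence the order [r^2]. *)
exists eps, (2 * W * (#|{: U * U}|%:R * C)); split => //.
  by rewrite !mulr_ge0.
move=> r r0 reps.
pose PT (p : U * U) (x : R) := product_self P (transversal gamma psi del h p r x).
have PT0 (p : U * U) x : (0 <= PT p x)%E by exact: measure_ge0.
have mPT (p : U * U) : measurable_fun (@I01 R) (PT p).
  apply: measurable_funTS; exact: measurable_transversal_mass.
pose H x := ((w x)%:E * energy (r / gamma ^+ q) x)%E.
pose T1 x := (\sum_(u : U) H (xu x u))%E.
pose T2 x := (\sum_(p : U * U) PT p x)%E.
have T10 x : I01 x -> (0 <= T1 x)%E.
  by move=> Ix; apply: sume_ge0 => u _; apply: wE0; exact: xu_I01.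
have T20 x : (0 <= T2 x)%E by apply: sume_ge0.
have mT1 : measurable_fun (@I01 R) T1.
  apply: emeasurable_sum => u.
  apply: (@measurable_comp _ _ _ _ _ _ (@I01 R)) => //.
    by move=> _ [x Ix <-]; exact: xu_I01.
    exact: mwEr.
  exact: measurable_funTS (measurable_xu u).
have mT2 : measurable_fun (@I01 R) T2 by exact: emeasurable_sum.
have k0 : 0 <= beta * gamma ^+ q by rewrite mulr_ge0// exprn_ge0 ?(ltW g0).
have k1 : 0 <= 2 * r * W by rewrite !mulr_ge0// ltW.
pose T3 x := ((beta * gamma ^+ q)%:E * T1 x + (2 * r * W)%:E * T2 x)%E.
have T30 x : I01 x -> (0 <= T3 x)%E.
  by move=> Ix; rewrite adde_ge0// mule_ge0// T10.
have mT3 : measurable_fun (@I01 R) T3.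
  by apply: emeasurable_funD; exact: measurable_funeM.
apply: (@le_trans _ _ (\int[leb]_(x in @I01 R) (((b%:R ^- q) ^+ 2)%:E * T3 x))%E).
  apply: ae_ge0_le_integral => //.
  - by move=> x Ix; exact: wE0.
  - exact: mwEr.
  - by move=> x Ix; rewrite mule_ge0 ?T30// lee_fin sqr_ge0.
  - exact: measurable_funeM.
  apply: ae_mono2 w_le Sigma_le => x wW hS Ix.
  have wx0 : (0 <= (w x)%:E)%E by rewrite lee_fin ltW// w_gt0.
  have := energy_pointwise gamma01 psi_periodic psi_derivable P_uniform V_ge0
    V_eps h0 hd S_strong r0 reps Ix.
  move=> /(lee_wpmul2l wx0)/le_trans; apply.
  rewrite muleCA; apply: lee_wpmul2l; first by rewrite lee_fin sqr_ge0.
  rewrite ge0_muleDr; last 2 first.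
  - apply: sume_ge0 => u _; rewrite mule_ge0 ?ball_energy_ge0// lee_fin.
    by rewrite mulr_ge0 ?exprn_ge0 ?(ltW g0)// sumr_ge0// => v _; exact: V_ge0.
  - by apply: sume_ge0 => p _; rewrite mule_ge0// lee_fin mulr_ge0// ltW.
  rewrite /T3; apply: leeD.
    rewrite /T1 !ge0_sume_distrr; last 2 first.
    - by move=> u _; apply: wE0; exact: xu_I01.
    - move=> u _; rewrite mule_ge0 ?ball_energy_ge0// lee_fin.
      by rewrite mulr_ge0 ?exprn_ge0 ?(ltW g0)// sumr_ge0// => v _; exact: V_ge0.
    apply: lee_sum => u _; rewrite /H !muleA; apply: lee_wpmul2r.
      exact: ball_energy_ge0.
    rewrite -!EFinM lee_fin mulrCA (mulrC beta) -mulrA ler_pM2l ?exprn_gt0//.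
    exact: (Sigma_weight u Ix (hS Ix)).
  rewrite /T2 !ge0_sume_distrr//; last first.
    by move=> p _; rewrite mule_ge0// lee_fin mulr_ge0// ltW.
  apply: lee_sum => p _; rewrite muleA; apply: lee_wpmul2r => //.
  by rewrite -EFinM lee_fin mulrC ler_wpM2l ?wW// mulr_ge0// ltW.
rewrite ge0_integralZl_EFin; [|exact: mI|..]; last 3 first.
- by [].
- by [].
- exact: sqr_ge0.
apply: lee_wpmul2l; first by rewrite lee_fin sqr_ge0.
rewrite /T3 ge0_integralD//; last 4 first.
- by move=> x Ix; rewrite mule_ge0 ?T10.
- exact: measurable_funeM.
- by move=> x Ix; rewrite mule_ge0.
- exact: measurable_funeM.
rewrite !ge0_integralZl_EFin//.
apply: leeD.
  rewrite /T1 (@ge0_integral_tile R b q H)//.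
  - by rewrite muleA -EFinM.
  - exact: mwEr.
  - by move=> x Ix; exact: wE0.
rewrite /T2 ge0_integral_sum//.
apply: (@le_trans _ _ ((2 * r * W)%:E * \sum_(p : U * U) (C * r)%:E)%E).
  apply: lee_wpmul2l => //.
  by apply: lee_sum => p _; exact: hC.
rewrite sumEFin sumr_const -[C * r *+ _]mulr_natl -EFinM lee_fin.
rewrite le_eqVlt; apply/orP; left; apply/eqP.
by rewrite expr2; ring.
Qed.

Lemma energy_bound : (1 <= q)%N -> exists r0 : R, exists K : R, [/\ 0 < r0, 0 <= K &
  forall n, (\int[leb]_(x in @I01 R) energy (r0 * (gamma ^+ q) ^+ n) x <=
     (K * (r0 * (gamma ^+ q) ^+ n) ^+ 2)%:E)%E].
Proof.
move=> q1; have [eps [C [eps0 C0 step]]] := energy_step.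
have /andP[_ g1] := gamma01.
pose k := gamma ^+ q; pose B := b%:R ^+ q : R.
have k0 : 0 < k by rewrite exprn_gt0.
have B0 : 0 < B by rewrite exprn_gt0.
have k1 : k <= 1 by rewrite exprn_ile1// ltW.
(* The largest radius allowed by [energy_step]; all later radii are smaller. *)
pose r0 := eps / 2.
have r00 : 0 < r0 by rewrite divr_gt0.
pose theta := beta / (k * B).
have kB0 : 0 < k * B by rewrite mulr_gt0.
have theta0 : 0 <= theta by rewrite divr_ge0// ltW.
have theta1 : theta < 1 by rewrite ltr_pdivrMr// mul1r -exprMn.
(* The first summand makes [K r^2] dominate [weighted_energy] at [r = r0], the
   second one gives [theta K + C / B^2 <= K]. *)
pose K := 2 * W / r0 + C / B ^+ 2 / (1 - theta).
have t1 : 0 < 1 - theta by rewrite subr_gt0.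
have p1 : 0 <= 2 * W / r0 by apply: divr_ge0; [rewrite mulr_ge0|exact: ltW].
have p2 : 0 <= C / B ^+ 2 / (1 - theta).
  by rewrite divr_ge0 ?(ltW t1)// divr_ge0// sqr_ge0.
have K0 : 0 <= K by rewrite addr_ge0.
pose r n := r0 * k ^+ n.
have rn0 n : 0 < r n by rewrite mulr_gt0// exprn_gt0.
have rn1 n : 2 * r n <= eps.
  rewrite /r /r0 mulrA (mulrC 2) divfK ?pnatr_eq0// ler_piMr ?(ltW eps0)//.
  by rewrite exprn_ile1// ltW.
have key n : (weighted_energy (r n) <= (K * r n ^+ 2)%:E)%E.
  elim: n => [|n ih].
    apply: (le_trans (weighted_energy_le (rn0 0%N))).
    rewrite lee_fin /r expr0 mulr1 /K [leRHS]mulrDl.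
    rewrite (_ : 2 * W / r0 * r0 ^+ 2 = W * (2 * r0)); last first.
      by field; rewrite gt_eqF.
    by rewrite lerDl mulr_ge0// sqr_ge0.
  apply: (le_trans (step _ (rn0 _) (rn1 _))).
  have -> : r n.+1 / gamma ^+ q = r n.
    by rewrite /r exprSr mulrA -/k mulfK// gt_eqF.
  apply: (@le_trans _ _ (((b%:R ^- q) ^+ 2)%:E *
    ((beta * gamma ^+ q * b%:R ^+ q)%:E * (K * r n ^+ 2)%:E + (C * r n.+1 ^+ 2)%:E))%E).
    apply: lee_wpmul2l; first by rewrite lee_fin sqr_ge0.
    apply: leeD => //; apply: lee_wpmul2l => //.
    by rewrite lee_fin !mulr_ge0// exprn_ge0 ?(ltW b0) ?(ltW g0).
  suff : B^-1 ^+ 2 * (beta * k * B * (K * r n ^+ 2) + C * r n.+1 ^+ 2) <=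
    K * r n.+1 ^+ 2 by rewrite -lee_fin.
  (* In terms of the new radius, the old square brings [k ^- 2], which turns [beta * k * B / B ^+ 2]
     into [theta]. *)
  have -> : r n = r n.+1 / k by rewrite /r exprSr mulrA mulfK// gt_eqF.
  have -> : (B^-1) ^+ 2 * (beta * k * B * (K * (r n.+1 / k) ^+ 2) + C * r n.+1 ^+ 2) =
    (theta * K + C / B ^+ 2) * r n.+1 ^+ 2.
    by rewrite /theta; field; rewrite !gt_eqF.
  apply: ler_wpM2r; first exact: sqr_ge0.
  rewrite -lerBrDl -{1}(mul1r K) -mulrBl /K mulrDr.
  rewrite [X in _ <= _ + X](_ : _ = C / B ^+ 2).
    by rewrite lerDr mulr_ge0// ltW.
  by rewrite mulrC divfK// gt_eqF.
exists r0, (M * K); split => //; first by rewrite mulr_ge0.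
move=> n; apply: (le_trans (energy_le_weighted _)).
rewrite -mulrA EFinM; apply: lee_wpmul2l => //.
exact: key.
Qed.

End energy_recursion.

(** * Densities *)

Lemma limn_einf_lt_frequently (R : realType) (u : (\bar R)^nat) (l : \bar R) (N : nat) :
  (limn_einf u < l)%E -> exists2 n, (N <= n)%N & (u n < l)%E.
Proof.
move=> ul; apply: contrapT => hN; move: ul; rewrite ltNge => /negP; apply.
rewrite limn_einf_lim; apply: lime_ge; first exact: is_cvg_einfs.
exists N => // m /= Nm; apply: le_ereal_inf_tmp => _ [n /= mn <-].
rewrite leNgt; apply/negP => unl; apply: hN; exists n => //.
exact: leq_trans mn.
Qed.

Lemma limn_einf_le (R : realType) (u : (\bar R)^nat) (l : \bar R) :
  (forall n, u n <= l)%E -> (limn_einf u <= l)%E.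
Proof.
move=> ul; rewrite limn_einf_lim; apply: lime_le; first exact: is_cvg_einfs.
apply: nearW => n; apply: le_trans (ul n); apply: ereal_inf_lbound.
by exists n => /=.
Qed.

Lemma measurable_fun_limn_einf d (T : measurableType d) (R : realType) (D : set T)
    (f : (T -> \bar R)^nat) : (forall n, measurable_fun D (f n)) ->
  measurable_fun D (fun x => limn_einf (f ^~ x)).
Proof.
move=> mf; rewrite /limn_einf; apply: measurableT_comp => //.
apply: (@measurable_fun_limn_esup _ _ _ _ (fun n x => - f n x)%E) => n.
exact: measurableT_comp.
Qed.

Lemma limn_einf_ge0 (R : realType) (u : (\bar R)^nat) :
  (forall n, 0 <= u n)%E -> (0 <= limn_einf u)%E.
Proof.
move=> u0; rewrite limn_einf_lim; apply: lime_ge; first exact: is_cvg_einfs.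
by apply: nearW => n; apply: le_ereal_inf_tmp => _ [m _ <-].
Qed.

Lemma integral_product_section (R : realType)
    (B : set (R * R)) (F : R * R -> R) :
  measurable B -> measurable_fun setT F -> (forall z, 0 <= F z) ->
  (\int[(@lebesgue_measure R \x @lebesgue_measure R)%E]_(z in B) (F z)%:E =
   \int[@lebesgue_measure R]_x \int[@lebesgue_measure R]_(y in xsection B x) (F (x, y))%:E)%E.
Proof.
move=> mB mF F0; rewrite integral_mkcond fubini_tonelli1/=.
- apply: eq_integral => x _; rewrite /fubini_F [RHS]integral_mkcond.
  by apply: eq_integral => y _; rewrite !patchE mem_xsection.
- apply/(measurable_restrictT _ _).1 => //.
  by apply/measurable_EFinP; exact: measurable_funTS.
- by move=> z; rewrite patchE; case: ifPn => // _; rewrite lee_fin.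
Qed.

Section density.
Variables (R : realType) (b : nat) (gamma : R) (psi : R -> R).
Hypothesis b_ge2 : (2 <= b)%N.
Hypothesis gamma01 : 0 < gamma < 1.
Hypothesis psi_periodic : forall x : R, psi (x + 1) = psi x.
Hypothesis psi_derivable : forall x : R, derivable psi x 1.
Local Notation Om := (SeqSpace (ltnW b_ge2)).
Local Notation leb := (@lebesgue_measure R).
Variable P : probability Om R.
Variables (r : nat -> R) (K : R).
Hypothesis r_gt0 : forall n, 0 < r n.
Hypothesis r_dec : forall i j, (i <= j)%N -> r j <= r i.
Hypothesis r_cvg : r @ \oo --> (0 : R).
Hypothesis energy_le : forall n,
  (\int[leb]_(x in @I01 R) ball_energy gamma psi P (r n) x <= (K * r n ^+ 2)%:E)%E.

Let avg n (z : R * R) : R := ball_mass gamma psi P (r n) z.1 z.2 / (2 * r n).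

Let mavg n : measurable_fun setT (avg n).
Proof.
apply: measurable_funM => //.
exact: measurable_ball_mass.
Qed.

Let avg_ge0 n z : 0 <= avg n z.
Proof. by rewrite divr_ge0 ?ball_mass_ge0// mulr_ge0// ltW. Qed.

(* [fine] sends an infinite upper limit to [0]; this only happens on a null set. *)
Definition srb_density (z : R * R) : R :=
  fine (limn_esup (fun n => (ball_mass gamma psi P (r n) z.1 z.2 / (2 * r n))%:E)).

Lemma measurable_srb_density : measurable_fun setT srb_density.
Proof.
apply: measurableT_comp; first exact: fine_measurable.
apply: (@measurable_fun_limn_esup _ _ _ _ (fun n z => (avg n z)%:E)) => n.
by apply/measurable_EFinP.
Qed.

Lemma srb_density_ge0 z : 0 <= srb_density z.
Proof.
apply: fine_ge0; apply: le_trans (limn_einf_sup _); apply: limn_einf_ge0 => n.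
by rewrite lee_fin; exact: avg_ge0.
Qed.

Let msec x : measurable_fun setT (fun y => srb_density (x, y)).
Proof. exact: (measurableT_comp measurable_srb_density (pair1_measurable x)). Qed.

Let normsq n x : \bar R := (\int[leb]_y (avg n (x, y) ^+ 2)%:E)%E.

Let normsqE n x :
  (normsq n x = ((4 * r n ^+ 2)^-1)%:E * ball_energy gamma psi P (r n) x)%E.
Proof.
rewrite /normsq /ball_energy -ge0_integralZl_EFin; [|exact: measurableT|..]; last 3 first.
- by move=> y _; rewrite lee_fin sqr_ge0.
- by apply/measurable_EFinP; apply: measurable_funX; exact: measurable_ball_mass_y.
- by rewrite invr_ge0 mulr_ge0// sqr_ge0.
apply: eq_integral => y _; rewrite -EFinM /avg /=; congr EFin.
by field; rewrite gt_eqF.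
Qed.

Let normsq_ge0 n x : (0 <= normsq n x)%E.
Proof. by apply: integral_ge0 => y _; rewrite lee_fin sqr_ge0. Qed.

Let mnormsq n : measurable_fun setT (normsq n).
Proof.
rewrite (_ : normsq n = fun x => (((4 * r n ^+ 2)^-1)%:E * ball_energy gamma psi P (r n) x)%E).
  by apply: measurable_funeM; exact: measurable_ball_energy.
by apply/funext => x; exact: normsqE.
Qed.

Let mI := @measurable_I01 R.

Let int_normsq n : (\int[leb]_(x in @I01 R) normsq n x <= (K / 4)%:E)%E.
Proof.
have i0 : 0 <= (4 * r n ^+ 2)^-1 by rewrite invr_ge0 mulr_ge0// sqr_ge0.
under eq_integral do rewrite normsqE.
rewrite ge0_integralZl_EFin//; last 2 first.
- by move=> x _; exact: ball_energy_ge0.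
- by apply: measurable_funTS; exact: measurable_ball_energy.
apply: (le_trans (lee_wpmul2l _ (energy_le n))); first by rewrite lee_fin.
rewrite -EFinM lee_fin le_eqVlt; apply/orP; left; apply/eqP.
by field; rewrite gt_eqF.
Qed.

Let liminf_normsq x := limn_einf (normsq ^~ x).

Let mliminf : measurable_fun setT liminf_normsq.
Proof. exact: measurable_fun_limn_einf. Qed.

Let int_liminf : (\int[leb]_(x in @I01 R) liminf_normsq x <= (K / 4)%:E)%E.
Proof.
apply: (@le_trans _ _ (limn_einf (fun n => \int[leb]_(x in @I01 R) normsq n x)%E)).
  apply: fatou; [exact: mI| |by move=> n x _].
  by move=> n; apply: measurable_funTS; exact: mnormsq.
exact: limn_einf_le.
Qed.

Let mSx (x : R) : measurable_fun setT (fun i : Om => S gamma psi x i : measurableTypeR R).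
Proof. exact: measurable_Sx. Qed.

(** The fibre measure [mx] bundled as a probability, so that the results on ball averages apply to
    it. *)
Let law (x : R) : probability (measurableTypeR R) R :=
  distribution P (HB.pack (fun i : Om => S gamma psi x i : measurableTypeR R)
    (isMeasurableFun.Build _ _ _ _ _ (mSx x)) : {mfun Om >-> measurableTypeR R}).

Let good (x : R) := [/\
  (forall B : set R, measurable B ->
     mx gamma psi P x B = \int[leb]_(y in B) (srb_density (x, y))%:E)%E,
  (\int[leb]_y ((srb_density (x, y)) ^+ 2)%:E <= liminf_normsq x)%E &
  (liminf_normsq x < +oo)%E].

(** A finite lower limit bounds the averages for infinitely many radii, which gives absolute
    continuity. The averages then converge almost everywhere to the density, so their upper limit
    equals it, and Fatou in [y] bounds its square. *)
Let goodP x : (liminf_normsq x < +oo)%E -> good x.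
Proof.
move=> hx.
have L0 : (0 <= liminf_normsq x)%E by exact: limn_einf_ge0.
(* Adding one makes the inequality strict, so that it holds for infinitely many indices. *)
pose L := fine (liminf_normsq x) + 1.
have hL : (liminf_normsq x < L%:E)%E.
  by rewrite /L EFinD fineK ?ge0_fin_numE// lteDl ?ge0_fin_numE// lte_fin.
have ac : law x `<< leb.
  apply: (null_dominates_ball_L2 r_gt0 r_dec r_cvg (L := L)) => N.
  by have [n Nn /ltW] := limn_einf_lt_frequently N hL; exists n.
have [g [mg g0 gE gcvg]] := ball_density r_gt0 r_cvg ac.
have gae : {ae leb, forall y, g y = srb_density (x, y)}.
  apply: ae_mono gcvg => y hy; rewrite /srb_density /=.
  have /cvg_limn_einf_sup[_ ->] : (fun n => (avg n (x, y))%:E) @ \oo --> (g y)%:E.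
    by apply: cvg_EFin; [exact: nearW|exact: hy].
  by [].
split => //.
- move=> B mB; transitivity (\int[leb]_(y in B) (g y)%:E)%E; first exact: gE.
  apply: ae_eq_integral => //.
  + by apply/measurable_EFinP; exact: measurable_funTS.
  + by apply/measurable_EFinP; apply: measurable_funTS; exact: msec.
  + by apply: ae_mono gae => y -> _.
- rewrite [leLHS](_ : _ = \int[leb]_y limn_einf (fun n => (avg n (x, y) ^+ 2)%:E))%E.
    apply: fatou => //.
    + move=> n; apply/measurable_EFinP; apply: measurable_funX.
      exact: (measurableT_comp (mavg n) (pair1_measurable x)).
    + by move=> n y _; rewrite lee_fin sqr_ge0.
  apply: ae_eq_integral => //.
  + by apply/measurable_EFinP; apply: measurable_funX; exact: msec.
  + apply: measurable_fun_limn_einf => n; apply/measurable_EFinP; apply: measurable_funX.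
    exact: (measurableT_comp (mavg n) (pair1_measurable x)).
  apply: ae_mono2 gcvg gae => y hy <- _.
  have /cvg_limn_einf_sup[-> _] // : (fun n => (avg n (x, y) ^+ 2)%:E) @ \oo --> (g y ^+ 2)%:E.
  apply: cvg_EFin; first exact: nearW.
  by rewrite expr2; under eq_fun do rewrite /= expr2; exact: cvgM.
Qed.

Let ae_good : {ae leb, forall x, I01 x -> good x}.
Proof.
have : leb.-integrable (@I01 R) liminf_normsq.
  apply/integrableP; split; first exact: measurable_funTS.
  apply: le_lt_trans (ltry (K / 4)); apply: le_trans int_liminf.
  rewrite le_eqVlt; apply/orP; left; apply/eqP; apply: eq_integral => x _.
  by rewrite gee0_abs//; exact: limn_einf_ge0.
move=> hi.
have : {ae leb, forall x, I01 x -> liminf_normsq x \is a fin_num}.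
  by apply: integrable_ae.
apply: ae_mono => x h Ix.
apply: goodP; have := h Ix; rewrite ge0_fin_numE//; exact: limn_einf_ge0.
Qed.

Lemma srb_density_L2 :
  (\int[(leb \x leb)%E]_(z in @I01 R `*` setT) ((srb_density z) ^+ 2)%:E < +oo)%E.
Proof.
rewrite (@integral_product_section R _ (fun z => srb_density z ^+ 2)); last 3 first.
- exact: measurableX.
- by apply: measurable_funX; exact: measurable_srb_density.
- by move=> z; exact: sqr_ge0.
apply: le_lt_trans (ltry (K / 4)); apply: le_trans int_liminf.
rewrite [leRHS]integral_mkcond.
apply: ae_ge0_le_integral => //.
- by move=> x _; apply: integral_ge0 => y _; rewrite lee_fin sqr_ge0.
- rewrite (_ : (fun x => _) = (fun x => \int[leb]_y (srb_density (x, y) ^+ 2)%:E)%E \_ (@I01 R)).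
    apply/(measurable_restrictT _ _).1 => //; apply: measurable_funTS.
    apply: (measurable_fun_fubini_tonelli_F (m2 := leb) (fun z => (srb_density z ^+ 2)%:E)).
      by apply/measurable_EFinP; apply: measurable_funX; exact: measurable_srb_density.
    by move=> z; rewrite lee_fin sqr_ge0.
  apply/funext => x; rewrite patchE; case: ifPn => Ix.
    congr (integral _ _ _); apply/seteqP; split => y //= _.
    by rewrite /xsection/= inE; split => //; exact: set_mem.
  rewrite (_ : xsection _ x = set0) ?integral_set0//.
  apply/seteqP; split => y //=; rewrite /xsection/= inE => -[/= Ix' _].
  by move/negP: Ix; apply; rewrite inE.
- by move=> x _; rewrite patchE; case: ifPn => // _; exact: limn_einf_ge0.
- by apply/(measurable_restrictT _ _).1 => //; exact: measurable_funTS.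
apply: ae_mono ae_good => x hx _; rewrite patchE; case: ifPn => Ix.
  have [_ h _] := hx (set_mem Ix).
  rewrite (_ : xsection _ x = setT)//; apply/seteqP; split => y //= _.
  by rewrite /xsection/= inE; split => //; exact: set_mem.
rewrite (_ : xsection _ x = set0) ?integral_set0//.
apply/seteqP; split => y //=; rewrite /xsection/= inE => -[/= Ix' _].
by move/negP: Ix; apply; rewrite inE.
Qed.

Lemma vartheta_density (B : set (R * R)) : measurable B -> B `<=` @I01 R `*` setT ->
  (vartheta gamma psi P B = \int[(leb \x leb)%E]_(z in B) (srb_density z)%:E)%E.
Proof.
move=> mB BI.
have d0 := srb_density_ge0; have md := measurable_srb_density.
rewrite integral_product_section// /vartheta integral_mkcond.
apply: ae_eq_integral => //.
- apply/(measurable_restrictT _ _).1 => //; apply: measurable_funTS.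
  (* Pulling [B] back to digit space makes the fibre masses measures of sections under the single
     measure [P], hence measurable in [x]. *)
  pose A := (fun p : R * Om => (p.1, S gamma psi p.1 p.2)) @^-1` B.
  have mA : measurable A.
    rewrite -[X in measurable X]setTI.
    have mpair : measurable_fun setT (fun p : R * Om => (p.1, S gamma psi p.1 p.2)).
      by apply: measurable_fun_pair; [exact: measurable_fst|exact: measurable_S].
    exact: mpair.
  have := measurable_fun_xsection P mA.
  suff -> : (fun x => mx gamma psi P x (xsection B x)) = (fun x => P (xsection A x)) by [].
  by apply/funext => x; rewrite /mx; congr (P _).
- rewrite (_ : (fun x => _) = fubini_F leb ((EFin \o srb_density) \_ B)).
    apply: measurable_fun_fubini_tonelli_F.
      apply/(measurable_restrictT _ _).1 => //; apply: measurable_funTS.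
      exact/measurable_EFinP.
    by move=> z; rewrite patchE; case: ifPn => // _; rewrite lee_fin.
  apply/funext => x; rewrite /fubini_F [LHS]integral_mkcond.
  by apply: eq_integral => y _; rewrite !patchE mem_xsection.
apply: ae_mono ae_good => x hx _; rewrite patchE; case: ifPn => Ix.
  by have [h _ _] := hx (set_mem Ix); apply: h; exact: measurable_xsection.
rewrite (_ : xsection B x = set0) ?integral_set0//.
apply/seteqP; split => y //=; rewrite /xsection/= inE => /BI[/= Ix' _].
by move/negP: Ix; apply; rewrite inE.
Qed.

Lemma ae_mx_density : {ae leb, forall x : R, @I01 R x ->
     exists g : R -> R,
       [/\ measurable_fun setT g,
           (forall y, 0 <= g y),
           (\int[leb]_y ((g y) ^+ 2)%:E < +oo)%E &
           forall B : set R, measurable B ->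
             mx gamma psi P x B = (\int[leb]_(y in B) (g y)%:E)%E]}.
Proof.
apply: ae_mono ae_good => x hx Ix; have [h1 h2 h3] := hx Ix.
exists (fun y => srb_density (x, y)); split => //.
- by move=> y; exact: srb_density_ge0.
- exact: le_lt_trans h3.
Qed.

End density.

(** * Choice of the constants and conclusion *)

(** The infimum ranges over extended reals. Taking the maximum with [0] makes the bound a
    nonnegative real, and [fine] sends the candidate [-oo] to [0]. *)
Lemma esssup01_lt (R : realType) (f : R -> R) (l : \bar R) :
  (esssup01 f < l)%E -> (0 < l)%E ->
  exists beta : R, [/\ 0 <= beta, (beta%:E < l)%E &
    {ae @lebesgue_measure R, forall x, I01 x -> f x <= beta}].
Proof.
move=> /ereal_inf_lt[y /= hy yl] l0.
exists (Num.max (fine y) 0); split.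
- by rewrite le_max lexx orbT.
- rewrite EFin_max gt_max l0 andbT.
  by case: y yl {hy} => [y| |] //= _; rewrite ?l0.
- apply: ae_mono hy => x hx Ix; have := hx Ix; rewrite le_max.
  case: y yl {hx} => [y _| |_] /=; last by rewrite leeNy_eq.
    by rewrite lee_fin => ->.
  by rewrite ltNge leey.
Qed.

Unset Implicit Arguments.

Theorem theorem2p2 (R : realType) (b : nat) (gamma : R) (psi : R -> R)
    (hb : (2 <= b)%N)
    (hgamma : (b%:R)^-1 < gamma < 1)
    (psi_periodic : forall x : R, psi (x + 1) = psi x)
    (psi_derivable : forall x : R, derivable psi x 1)
    (psi'_continuous : continuous (derive1 psi))
    (P : probability (SeqSpace (ltnW hb)) R)
    (P_uniform : uniform_bernoulli P)
    (hq : exists q : nat, (1 <= q)%N /\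
            (sigma b gamma psi q < ((gamma * b%:R) ^+ q)%:E)%E) :
  (exists f : R * R -> R,
     [/\ measurable_fun setT f,
         (forall z, 0 <= f z),
         (\int[(@lebesgue_measure R \x @lebesgue_measure R)%E]_(z in (@I01 R) `*` setT)
             ((f z) ^+ 2)%:E < +oo)%E &
         forall B : set (R * R), measurable B -> B `<=` (@I01 R) `*` setT ->
           vartheta gamma psi P B =
           (\int[(@lebesgue_measure R \x @lebesgue_measure R)%E]_(z in B) (f z)%:E)%E])
  /\
  {ae @lebesgue_measure R, forall x : R, @I01 R x ->
     exists g : R -> R,
       [/\ measurable_fun setT g,
           (forall y, 0 <= g y),
           (\int[@lebesgue_measure R]_y ((g y) ^+ 2)%:E < +oo)%E &
           forall B : set R, measurable B ->
             mx gamma psi P x B = (\int[@lebesgue_measure R]_(y in B) (g y)%:E)%E]}.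
Proof.
have b0 : 0 < b%:R :> R by rewrite ltr0n; exact: ltnW.
have /andP[bg g1] := hgamma.
have g0 : 0 < gamma by apply: lt_trans bg; rewrite invr_gt0.
have gamma01 : 0 < gamma < 1 by rewrite g0.
(* [sigma] is an infimum, so a single pair [w], [V] already lies below the threshold. *)
have [q [q1 /ereal_inf_lt[_ [w [V [w_weight V_test V_adm ->]]] Vlt]]] := hq.
have [mw [w_gt0 [w_fin winv_fin]]] := w_weight.
have [W [W0 _ hW]] := esssup01_lt w_fin (ltry 0).
have [M [M0 _ hM]] := esssup01_lt winv_fin (ltry 0).
have gb0 : (0 < ((gamma * b%:R) ^+ q)%:E)%E by rewrite lte_fin exprn_gt0// mulr_gt0.
have [beta [beta0 beta_lt Sigma_le]] := esssup01_lt Vlt gb0.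
rewrite lte_fin in beta_lt.
have w_le : {ae @lebesgue_measure R, forall x, I01 x -> w x <= W}.
  by apply: ae_mono hW => x hx Ix; exact: le_trans (ler_norm _) (hx Ix).
have winv_le : {ae @lebesgue_measure R, forall x, I01 x -> (w x)^-1 <= M}.
  by apply: ae_mono hM => x hx Ix; exact: le_trans (ler_norm _) (hx Ix).
have [r0 [K [r00 K0 energy_le]]] := energy_bound gamma01 psi_periodic psi_derivable
  psi'_continuous P_uniform V_test V_adm mw w_gt0 w_le winv_le Sigma_le W0 M0 beta0
  beta_lt q1.
pose r n := r0 * (gamma ^+ q) ^+ n.
have k0 : 0 < gamma ^+ q by rewrite exprn_gt0.
(* Here [1 <= q] enters: the radii must tend to [0]. *)
have k1 : gamma ^+ q < 1 by rewrite exprn_ilt1 ?(ltW g0)// -lt0n.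
have r_gt0 n : 0 < r n by rewrite mulr_gt0// exprn_gt0.
have r_dec i j : (i <= j)%N -> r j <= r i.
  by move=> ij; rewrite ler_pM2l// ler_wiXn2l// ltW.
have r_cvg : r @ \oo --> (0 : R).
  rewrite -(mulr0 r0); apply: cvgM; first exact: cvg_cst.
  by apply: cvg_expr; rewrite gtr0_norm.
split; last first.
  exact: (ae_mx_density gamma01 psi_periodic psi_derivable r_gt0 r_dec r_cvg energy_le).
exists (srb_density gamma psi P r); split.
- exact: measurable_srb_density.
- exact: srb_density_ge0.
- exact: (srb_density_L2 gamma01 psi_periodic psi_derivable r_gt0 r_dec r_cvg energy_le).
- exact: (vartheta_density gamma01 psi_periodic psi_derivable r_gt0 r_dec r_cvg energy_le).
Qed.
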